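(* Suppose that $n=2m$ is even. Let $b$ and $\psi$ be compatible forms on the $2n$-dimensional $E$-vector space $W$, with good basis $e_1,\dots,e_{2n}$, let $W_1=\operatorname{span}_E\{e_1,\dots,e_n\}$, let $\lambda=a_ia_{n+i}\in E_0$ ($1\le i\le n$), and let $D=\det(\psi|W_1)=a_1\cdots a_n$. Call an element of $E_0^*$ a norm if it lies in $\mathrm{Nm}_{E/E_0}(E^* )\subseteq E_0^*$. Then, for the $E[G_1]$-modules $S^\pm$: (i) Both of the representations $S^+$ and $S^-$ can be defined over $E_0$ if and only if $(-1)^mD$ and $(-1)^mD\lambda$ are both norms. (ii) $S^+$ can be defined over $E_0$ and $S^-$ cannot be defined over $E_0$ if and only if either $m$ is even, $(-1)^mD$ is a norm and $(-1)^mD\lambda$ is not a norm, or $m$ is odd, $(-1)^mD$ is not a norm and $(-1)^mD\lambda$ is a norm. (iii) $S^-$ can be defined over $E_0$ and $S^+$ cannot be defined over $E_0$ if and only if either $m$ is odd, $(-1)^mD$ is a norm and $(-1)^mD\lambda$ is not a norm, or $m$ is even, $(-1)^mD$ is not a norm and $(-1)^mD\lambda$ is a norm. (iv) Neither of the representations $S^+$, $S^-$ can be defined over $E_0$ if and only if neither $(-1)^mD$ nor $(-1)^mD\lambda$ is a norm.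
   Context: $E_0$ is a totally real number field or $\mathbb{R}$, and $E$ is an imaginary (totally imaginary) quadratic extension of $E_0$ ($E=\mathbb{C}$ if $E_0=\mathbb{R}$); $\alpha\mapsto\bar\alpha$ is the nontrivial element of $\mathrm{Gal}(E/E_0)$. $\mathrm{Res}_{E/E_0}$ denotes Weil restriction. Forms. $W$ is an $E$-vector space of dimension $2n$, $b$ a nondegenerate symmetric $E$-bilinear form and $\psi$ a nondegenerate $(E,E_0)$-Hermitian form (linear in the first variable). $b$ and $\psi$ are compatible, with good basis $e_1,\dots,e_{2n}$, if, writing $z=\sum z_ie_i$, $w=\sum w_ie_i$, we have $b(z,w)=\sum_{i=1}^n(z_iw_{n+i}+z_{n+i}w_i)$, $\psi(z,w)=\sum_{i=1}^{2n}a_iz_i\bar w_i$ with $a_i\in E_0$ nonzero, and there is $\lambda\in E_0$ with $a_ia_{n+i}=\lambda$ for all $1\le i\le n$. Groups. $G(W,b,\psi)$ is the algebraic group over $E_0$ given by the intersection of $\mathrm{Res}_{E/E_0}\mathrm{SO}(W,b)$ and $\mathrm{SU}(W,\psi)$. $G_1$ is the neutral component of its preimage in $\mathrm{Res}_{E/E_0}\mathrm{Spin}(W,b)$ under the double cover homomorphism; it is an algebraic group over $E_0$. Half spin representations. $S^+=\bigwedge^{\mathrm{even}}W_1$ and $S^-=\bigwedge^{\mathrm{odd}}W_1$ (exterior powers over $E$), with $\mathrm{Spin}(W,b)\subseteq C^{\mathrm{even}}(W,b)^*$ acting via the Clifford module structure in which $e_i$ ($i\le n$) acts by wedge product with $e_i$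 and $e_{n+i}$ acts by $2$ times the interior product with the dual basis vector $e_i^*\in W_1^\vee$ (Clifford relations $e_ie_{n+i}+e_{n+i}e_i=2$, all other pairs anticommuting and $e_r^2=0$). $G_1$ acts on $S^\pm$ by restriction. An $E[G_1]$-module $S$ can be defined over $E_0$ if there is an $E_0[G_1]$-module $S_0$ with $S_0\otimes_{E_0}E\cong S$ as $E[G_1]$-modules. *)

(* Defs.v *)
From HB Require Import structures.
From mathcomp Require Import all_boot all_order all_algebra all_field.
From mathcomp Require Import reals.
Set Implicit Arguments.
Unset Strict Implicit.
Unset Printing Implicit Defensive.
Import Order.TTheory GRing.Theory Num.Theory.
Import VectorInternalTheory.
Local Open Scope ring_scope.

(* [tens K B] is K (x)_F B for a finite-dimensional F-algebra K and a          *)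
(* commutative F-algebra B.  The row (c_i) stands for sum_i v_i (x) c_i, where *)
(* v_i is the i-th vector of the basis of K underlying [v2r] and [r2v].        *)
Definition tens (F : fieldType) (K : falgType F) (B : comAlgType F) : Type :=
  'rV[B]_(dim K).

HB.instance Definition _ (F : fieldType) (K : falgType F) (B : comAlgType F) :=
  GRing.Zmodule.on (tens K B).

Section Tensor.
Variables (F : fieldType) (K : falgType F) (B : comAlgType F).
Implicit Types (a : K) (c : B) (x y z : tens K B).

Definition tbase (i : 'I_(dim K)) : K := r2v (delta_mx 0 i).

Definition tcoef x (i : 'I_(dim K)) : B := (x : 'rV[B]_(dim K)) 0 i.

Definition pure a c : tens K B :=
  (\row_i (c * (v2r a 0 i)%:A) : 'rV[B]_(dim K)).

Definition tens_one : tens K B := pure 1 1.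

Definition tens_mul x y : tens K B :=
  \sum_i \sum_j pure (tbase i * tbase j) (tcoef x i * tcoef y j).

Lemma tcoefP x y : tcoef x =1 tcoef y -> x = y.
Proof. by move=> h; apply/rowP => i; exact: h. Qed.

Lemma tcoef_pure a c i : tcoef (pure a c) i = c * (v2r a 0 i)%:A.
Proof. by rewrite /tcoef mxE. Qed.

Lemma tcoefD x y i : tcoef (x + y) i = tcoef x i + tcoef y i.
Proof. by rewrite /tcoef mxE. Qed.

Lemma pureDl a a' c : pure (a + a') c = pure a c + pure a' c.
Proof.
by apply: tcoefP => i; rewrite tcoefD !tcoef_pure linearD mxE scalerDl mulrDr.
Qed.

Lemma pureDr a c c' : pure a (c + c') = pure a c + pure a c'.
Proof. by apply: tcoefP => i; rewrite tcoefD !tcoef_pure mulrDl. Qed.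

Lemma pureZ (k : F) a c : pure (k *: a) c = pure a (k *: c).
Proof.
apply: tcoefP => i; rewrite !tcoef_pure linearZ mxE -scalerA.
by rewrite -scalerAr -scalerAl.
Qed.

Lemma pure0l c : pure 0 c = 0.
Proof. by apply: (addrI (pure 0 c)); rewrite -pureDl !addr0. Qed.

Lemma pure0r a : pure a 0 = 0.
Proof. by apply: (addrI (pure a 0)); rewrite -pureDr !addr0. Qed.

Lemma pure_suml I (r : seq I) (f : I -> K) c :
  pure (\sum_(i <- r) f i) c = \sum_(i <- r) pure (f i) c.
Proof. by apply: (big_morph (pure^~ c)) => [a a'|]; rewrite ?pureDl ?pure0l. Qed.

Lemma pure_sumr I (r : seq I) a (f : I -> B) :
  pure a (\sum_(i <- r) f i) = \sum_(i <- r) pure a (f i).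
Proof. by apply: (big_morph (pure a)) => [c c'|]; rewrite ?pureDr ?pure0r. Qed.

Lemma tbase_sum a : a = \sum_i v2r a 0 i *: tbase i.
Proof.
apply: v2r_inj; rewrite linear_sum [LHS]row_sum_delta.
by apply: eq_bigr => i _; rewrite linearZ /= r2vK.
Qed.

Lemma tens_sum x : x = \sum_i pure (tbase i) (tcoef x i).
Proof.
have scoef I r (f : I -> tens K B) j :
    tcoef (\sum_(i <- r) f i) j = \sum_(i <- r) tcoef (f i) j.
  by apply: (big_morph (tcoef^~ j)) => [u v|]; rewrite ?tcoefD // /tcoef mxE.
apply: tcoefP => j; rewrite scoef (bigD1 j) //= big1 ?addr0.
  by rewrite tcoef_pure r2vK mxE !eqxx scale1r mulr1.
by move=> i ne; rewrite tcoef_pure r2vK mxE eqxx eq_sym (negPf ne) scale0r mulr0.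
Qed.

Lemma tens_mulDl : left_distributive tens_mul +%R.
Proof.
move=> x y z; rewrite /tens_mul -big_split; apply: eq_bigr => i _.
rewrite -big_split; apply: eq_bigr => j _ /=.
by rewrite tcoefD mulrDl pureDr.
Qed.

Lemma tens_mulDr : right_distributive tens_mul +%R.
Proof.
move=> x y z; rewrite /tens_mul -big_split; apply: eq_bigr => i _.
rewrite -big_split; apply: eq_bigr => j _ /=.
by rewrite tcoefD mulrDr pureDr.
Qed.

Lemma tens_mul_pure a a' c c' :
  tens_mul (pure a c) (pure a' c') = pure (a * a') (c * c').
Proof.
rewrite {2}(tbase_sum a) {2}(tbase_sum a') mulr_suml pure_suml.
apply: eq_bigr => i _; rewrite mulr_sumr pure_suml; apply: eq_bigr => j _.
rewrite !tcoef_pure !mulr_algr -(scalerAl (v2r a 0 i) (tbase i)).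
rewrite -(scalerAr (v2r a' 0 j) (tbase i)) !pureZ -scalerAl -scalerAr.
by rewrite !scalerA (mulrC (v2r a 0 i)).
Qed.

Lemma tens_mul0l x : tens_mul 0 x = 0.
Proof. by apply: (addrI (tens_mul 0 x)); rewrite -tens_mulDl !addr0. Qed.

Lemma tens_mul0r x : tens_mul x 0 = 0.
Proof. by apply: (addrI (tens_mul x 0)); rewrite -tens_mulDr !addr0. Qed.

Lemma tens_ind (P : tens K B -> Prop) :
  P 0 -> (forall x y, P x -> P y -> P (x + y)) -> (forall a c, P (pure a c)) ->
  forall x, P x.
Proof. by move=> P0 PD Pp x; rewrite (tens_sum x); elim/big_ind: _. Qed.

Lemma tens_mulA : associative tens_mul.
Proof.
elim/tens_ind => [||a c]; first by move=> y z; rewrite !tens_mul0l.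
  by move=> x x' hx hx' y z; rewrite !tens_mulDl hx hx'.
elim/tens_ind => [||a' c']; first by move=> z; rewrite !(tens_mul0l, tens_mul0r).
  by move=> x x' hx hx' z; rewrite !(tens_mulDl, tens_mulDr) hx hx'.
elim/tens_ind => [||a2 c2]; first by rewrite !tens_mul0r.
  by move=> x x' hx hx'; rewrite !tens_mulDr hx hx'.
by rewrite !tens_mul_pure !mulrA.
Qed.

Lemma tens_mul1 : left_id tens_one tens_mul.
Proof.
elim/tens_ind => [|x y hx hy|a c]; first by rewrite tens_mul0r.
  by rewrite tens_mulDr hx hy.
by rewrite tens_mul_pure !mul1r.
Qed.

Lemma tens_1mul : right_id tens_one tens_mul.
Proof.
elim/tens_ind => [|x y hx hy|a c]; first by rewrite tens_mul0l.
  by rewrite tens_mulDl hx hy.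
by rewrite tens_mul_pure !mulr1.
Qed.

Lemma tens_one_neq0 : tens_one != 0.
Proof.
apply/negP => /eqP h; have: v2r (1 : K) != 0.
  by apply: contra_neq (oner_neq0 K) => h1; apply: v2r_inj; rewrite h1 linear0.
move=> /eqP; apply; apply/rowP => i; move: (congr1 (tcoef^~ i) h).
rewrite tcoef_pure /tcoef !mxE mul1r => /eqP.
by rewrite scaler_eq0 oner_eq0 orbF => /eqP.
Qed.

HB.instance Definition _ := GRing.Zmodule_isNzRing.Build (tens K B)
  tens_mulA tens_mul1 tens_1mul tens_mulDl tens_mulDr tens_one_neq0.

Lemma pureM a a' c c' : pure a c * pure a' c' = pure (a * a') (c * c').
Proof. exact: tens_mul_pure. Qed.

End Tensor.

Definition tens_map (F : fieldType) (K : falgType F) (B B' : comAlgType F)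
    (h : B -> B') (x : tens K B) : tens K B' :=
  \sum_i pure (tbase i) (h (tcoef x i)).

Section ExtensionOfScalars.
Variables (F : fieldType) (K : fieldExtType F) (B : comAlgType F).

Lemma tens_mulC : commutative (@tens_mul F K B).
Proof.
elim/tens_ind => [|x x' hx hx'|a c] y; first by rewrite tens_mul0l tens_mul0r.
  by rewrite tens_mulDl tens_mulDr hx hx'.
elim/tens_ind: y => [|x x' hx hx'|a' c']; first by rewrite tens_mul0l tens_mul0r.
  by rewrite tens_mulDl tens_mulDr hx hx'.
by rewrite !tens_mul_pure mulrC [c * _]mulrC.
Qed.

(* K (x)_F B regarded as a commutative K-algebra *)
Definition extend : Type := tens K B.
HB.instance Definition _ := GRing.NzRing.on extend.
HB.instance Definition _ :=
  GRing.PzRing_hasCommutativeMul.Build extend tens_mulC.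

Definition extend_scale (a : K) (x : extend) : extend := pure a 1 * x.

Fact extend_scaleA a a' x :
  extend_scale a (extend_scale a' x) = extend_scale (a * a') x.
Proof. by rewrite /extend_scale mulrA pureM mulr1. Qed.
Fact extend_scale1 : left_id 1 extend_scale.
Proof. by move=> x; rewrite /extend_scale mul1r. Qed.
Fact extend_scaleDr : right_distributive extend_scale +%R.
Proof. by move=> a x y; rewrite /extend_scale mulrDr. Qed.
Fact extend_scaleDl x : {morph extend_scale^~ x : a a' / a + a'}.
Proof. by move=> a a'; rewrite /extend_scale pureDl mulrDl. Qed.

HB.instance Definition _ := GRing.Zmodule_isLmodule.Build K extend
  extend_scaleA extend_scale1 extend_scaleDr extend_scaleDl.

Fact extend_scaleAl (a : K) (x y : extend) : a *: (x * y) = a *: x * y.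
Proof. exact: mulrA. Qed.
HB.instance Definition _ := GRing.Lmodule_isLalgebra.Build K extend extend_scaleAl.
HB.instance Definition _ := GRing.Lalgebra_isComAlgebra.Build K extend.

End ExtensionOfScalars.
Arguments extend {F} K B.

Section Fields.

Definition number_field (E0 : fieldType) : Prop :=
  exists (L : fieldExtType rat) (f : {rmorphism L -> E0}), bijective f.

Definition totally_real (E0 : fieldType) : Prop :=
  forall (f : {rmorphism E0 -> algC}) (x : E0), f x \is Num.real.

Definition totally_imaginary (E : fieldType) : Prop :=
  forall f : {rmorphism E -> algC}, exists x : E, f x \isn't Num.real.

Definition isomorphic_to_reals (E0 : fieldType) : Prop :=
  exists (R : realType) (f : {rmorphism R -> E0}), bijective f.

Variables (E0 : fieldType) (E : fieldExtType E0) (conj : {lrmorphism E -> E}).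

(* When E0 is the field of real numbers, degree 2 forces E to be the field of *)
(* complex numbers.                                                           *)
Definition imaginary_quadratic : Prop :=
  \dim {:E} = 2 /\
  (number_field E0 /\ totally_real E0 /\ totally_imaginary E
   \/ isomorphic_to_reals E0).

(* E0-linearity is part of the type of conj. *)
Definition is_conjugation : Prop := exists x : E, conj x != x.

Definition is_norm (x : E0) : Prop := exists2 z : E, z != 0 & x%:A = z * conj z.

Section Forms.
Variables (W : vectType E) (n : nat).

Record good_basis (b psi : W -> W -> E) (e : (n + n).-tuple W)
    (a : 'I_(n + n) -> E0) (lambda : E0) : Prop := GoodBasis {
  gb_basis : basis_of fullv e;
  gb_sym : forall z w : W, b z w =
    \sum_(i < n) (coord e (lshift n i) z * coord e (rshift n i) w
                + coord e (rshift n i) z * coord e (lshift n i) w);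
  gb_herm : forall z w : W, psi z w =
    \sum_(i < n + n) (a i)%:A * coord e i z * conj (coord e i w);
  gb_neq0 : forall i, a i != 0;
  gb_lambda : forall i : 'I_n, a (lshift n i) * a (rshift n i) = lambda }.

Definition clifford_map (b : W -> W -> E) (D : algType E) (f : W -> D) : Prop :=
  forall w, f w * f w = (b w w)%:A.

Definition is_clifford_algebra (b : W -> W -> E) (C : falgType E)
    (iota : {linear W -> C}) : Prop :=
  clifford_map b iota /\
  forall (D : algType E) (f : {linear W -> D}), clifford_map b f ->
    exists g : {lrmorphism C -> D}, (forall w, g (iota w) = f w) /\
      forall g' : {lrmorphism C -> D}, (forall w, g' (iota w) = f w) -> g' =1 g.

(* The exterior algebra of W_1 = span(e_1, ..., e_n): the function s stands   *)
(* for the sum over I = {i_1 < ... < i_k} of s(I) e_{i_1} /\ ... /\ e_{i_k}.  *)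
Definition exterior : Type := {ffun {set 'I_n} -> E^o}.
HB.instance Definition _ := GRing.Lmodule.on exterior.

Definition exterior_basis (J : {set 'I_n}) : exterior :=
  [ffun I => (I == J)%:R].

Definition exterior_sign (i : 'I_n) (I : {set 'I_n}) : E :=
  (-1) ^+ #|[set j in I | (j < i)%N]|.

Definition wedge (i : 'I_n) (s : exterior) : exterior :=
  [ffun I : {set 'I_n} =>
    if i \in I then exterior_sign i I * s (I :\ i) else 0].

Definition interior (i : 'I_n) (s : exterior) : exterior :=
  [ffun I : {set 'I_n} =>
    if i \in I then 0 else exterior_sign i I * s (i |: I)].

Record is_spin_module (C : falgType E) (iota : W -> C) (e : (n + n).-tuple W)
    (act : C -> {linear exterior -> exterior}) : Prop := SpinModule {
  sm_add : forall x y s, act (x + y) s = act x s + act y s;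
  sm_scale : forall (k : E) x s, act (k *: x) s = k *: act x s;
  sm_one : forall s, act 1 s = s;
  sm_mul : forall x y s, act (x * y) s = act x (act y s);
  sm_wedge : forall (i : 'I_n) s,
    act (iota (tnth e (lshift n i))) s = wedge i s;
  sm_interior : forall (i : 'I_n) s,
    act (iota (tnth e (rshift n i))) s = 2%:R *: interior i s }.

End Forms.

End Fields.

Section Points.
Variables (E0 : fieldType) (E : fieldExtType E0) (conj : {lrmorphism E -> E}).
Variables (W : vectType E) (n : nat) (b psi : W -> W -> E).
Variable e : (n + n).-tuple W.
Variables (C : falgType E) (iota : {linear W -> C}).
Variable act : C -> {linear exterior E n -> exterior E n}.

Section OverE.
Variable B : comAlgType E.

Definition gram (f : W -> W -> E) : 'M[B]_(n + n) :=
  \matrix_(i, j) (f (tnth e i) (tnth e j))%:A.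

(* A matrix g stands for the endomorphism e_i |-> sum_j g i j e_j of W (x) B. *)
Definition SO_points (g : 'M[B]_(n + n)) : Prop :=
  g *m gram b *m g^T = gram b /\ \det g = 1.

(* The list s stands for the sum over its items (c, [:: w_1; ...; w_k]) of    *)
(* w_1 ... w_k (x) c in C (x)_E B.                                            *)
Definition clifford_expr (s : seq (B * seq W)) : tens C B :=
  \sum_(t <- s) pure (\prod_(w <- t.2) iota w) t.1.

Definition even_expr (s : seq (B * seq W)) : bool :=
  all (fun t => ~~ odd (size t.2)) s.

Definition rev_expr (s : seq (B * seq W)) : seq (B * seq W) :=
  [seq (t.1, rev t.2) | t <- s].

Definition covers (x : tens C B) (g : 'M[B]_(n + n)) : Prop :=
  forall i, x * pure (iota (tnth e i)) 1 =
            (\sum_j pure (iota (tnth e j)) (g i j)) * x.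

(* Spin(B): even x, inverse to its own reversal, with x W_B x^-1 in W_B. *)
Definition Spin_points (x : tens C B) : Prop :=
  (exists s, [/\ even_expr s, x = clifford_expr s
               & x * clifford_expr (rev_expr s) = 1
                 /\ clifford_expr (rev_expr s) * x = 1])
  /\ (exists g : 'M[B]_(n + n), covers x g).

End OverE.

Section OverE0.
Variable A : comAlgType E0.

(* For A-points of Weil restrictions from E to E0, take B = E (x) A above. *)
Definition conj_extend (x : extend E A) : extend E A :=
  \sum_i pure (conj (tbase i)) (tcoef x i).

Definition SU_points (g : 'M[extend E A]_(n + n)) : Prop :=
  g *m gram (extend E A) psi *m (map_mx conj_extend g)^T
    = gram (extend E A) psi /\ \det g = 1.

Definition G_points (g : 'M[extend E A]_(n + n)) : Prop :=
  SO_points g /\ SU_points g.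

Definition point : Type := tens C (extend E A).
HB.instance Definition _ := GRing.NzRing.on point.

Definition G_preimage (x : point) : Prop :=
  Spin_points x /\ (exists2 g, covers x g & G_points g).

End OverE0.

Definition point_map (A A' : comAlgType E0) (h : A -> A') (x : point A) :
    point A' :=
  tens_map (fun y : extend E A => tens_map h y : extend E A') x.

Definition subfunctor : Type := forall A : comAlgType E0, point A -> Prop.

(* By the Yoneda lemma, a regular function on an affine E0-scheme X is a      *)
(* natural transformation from its functor of points to the affine line.      *)
Definition regular_function (X : subfunctor)
    (f : forall A : comAlgType E0, point A -> A) : Prop :=
  forall (A A' : comAlgType E0) (h : {lrmorphism A -> A'}) (x : point A),
    X A x -> f A' (point_map h x) = h (f A x).

(* The open and closed subschemes of X are the loci f = 1 of the idempotent   *)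
(* regular functions f; the neutral component is the intersection of those    *)
(* which contain the identity.                                                *)
Definition neutral_component (X : subfunctor) : subfunctor := fun A x =>
  X A x /\
  forall f, regular_function X f ->
    (forall (A' : comAlgType E0) (y : point A'),
       X A' y -> f A' y * f A' y = f A' y) ->
    (forall A' : comAlgType E0, f A' 1 = 1) ->
  f A x = 1.

Definition G1 : subfunctor := neutral_component G_preimage.

(* [odd_part] selects S^- when true and S^+ when false. *)
Definition half_index (odd_part : bool) : {set {set 'I_n}} :=
  [set I : {set 'I_n} | odd #|I| == odd_part].

(* the matrix of the action on S^+ or S^-, acting on column vectors *)
Definition half_spin (odd_part : bool) (A : comAlgType E0) (x : point A) :
    'M[extend E A]_#|half_index odd_part| :=
  \matrix_(i, j) \sum_k tcoef x k *
    (act (tbase k) (exterior_basis E (enum_val j)) (enum_val i))%:A.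

Record is_module (X : subfunctor) (d : nat)
    (rho : forall A : comAlgType E0, point A -> 'M[A]_d) : Prop := IsModule {
  module_natural : forall (A A' : comAlgType E0) (h : {lrmorphism A -> A'})
      (x : point A), X A x -> rho A' (point_map h x) = map_mx h (rho A x);
  module_one : forall A : comAlgType E0, rho A 1 = 1%:M;
  module_mul : forall (A : comAlgType E0) (x y : point A),
    X A x -> X A y -> rho A (x * y) = rho A x *m rho A y }.

(* P is the matrix of an isomorphism from S^+ or S^- to S_0 (x) E. *)
Definition defined_over_E0 (odd_part : bool) : Prop :=
  exists (rho : forall A : comAlgType E0, point A -> 'M[A]_#|half_index odd_part|)
         (P : 'M[E]_#|half_index odd_part|),
    [/\ is_module G1 rho, P \in unitmx &
        forall (A : comAlgType E0) (x : point A), G1 x ->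
          map_mx (in_alg (extend E A)) P *m half_spin odd_part x =
          map_mx (fun c : A => pure 1 c : extend E A) (rho A x)
            *m map_mx (in_alg (extend E A)) P].

End Points.

(* Main.v *)
(* Write S^p for the half spin module of parity p. The forms define an antilinear
   map J of W by psi(z, w) = b(z, J w); it sends e_r to a_r e_(r +- n), satisfies
   J^2 = lambda, and commutes with G. Up to a factor depending on the parity, J
   is implemented on spinors by a monomial map [star], e_I |-> c_I e_(~I) followed
   by conjugation, which commutes with G_1 on each S^p because n is even: a point
   of the preimage of G commutes with it up to a sign, and this sign
   s, for which (1 + s)/2 is an idempotent regular function, is trivial on G_1.
   The square of the antilinear map is a scalar c_p of E0, equal modulo norms to
   (-1)^m D if p = m modulo 2 and to (-1)^m D lambda otherwise.
   If c_p is a norm, Hilbert 90 for GL_d descends S^p to E0. Conversely, the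
   points 1 + eps y over the dual numbers, for y in the Lie algebra of G, belong to
   G_1 since they reduce to 1 modulo eps; over E they span so(W), whose commutant
   on S^p is scalar, so a descent of S^p differs from [star] by a scalar mu
   with mu (conj mu) = c_p. *)
Require Import Defs.
From HB Require Import structures.
From mathcomp Require Import all_boot all_order all_algebra all_field.
From mathcomp Require Import reals.
From mathcomp Require Import ring zify boolp.
Set Implicit Arguments.
Unset Strict Implicit.
Unset Printing Implicit Defensive.
Import Order.TTheory GRing.Theory Num.Theory.
Import VectorInternalTheory.
Local Open Scope ring_scope.

(** * Tensor products over a base algebra *)

(** Nothing about the geometry of G_1 is computed: it is reached only through idempotent functions,
    from above by one such function on the preimage, from below by points where all of them are 1.
    Points live over arbitrary algebras, so Schur's lemma is proved over any commutative ring
    receiving E, by comparing matrix entries. For a point of the preimage it yields only an unknown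
    scalar in E (x) A. That this scalar squares to 1 is forced by the spinor norm: because n is
    even, each S^p carries a bilinear form for which reversal in the Clifford algebra is the
    adjoint, so spin elements preserve it. Applying the relation twice then puts the scalar in A.
    The map J scales b by lambda, and lambda may have no square root in E_0. Only products of two
    generators have to be implemented, so [star] carries one factor lambda^-1 for every second
    generator. This rounding is what makes the constant c_p depend on the parity p. *)

Section TensorFunctor.
Variables (F : fieldType) (K : falgType F) (B B' : comAlgType F).

Lemma tens_mapD (h : {lrmorphism B -> B'}) : {morph tens_map (K := K) h : x y / x + y}.
Proof.
move=> x y; rewrite /tens_map -big_split; apply: eq_bigr => i _ /=.
by rewrite tcoefD rmorphD pureDr.
Qed.

Lemma tens_map_pure (h : {lrmorphism B -> B'}) a c :
  tens_map h (pure a c) = pure (K := K) a (h c).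
Proof.
rewrite [RHS]tens_sum; apply: eq_bigr => i _; congr pure.
by rewrite !tcoef_pure !mulr_algr linearZ.
Qed.

Lemma tens_mapM (h : {lrmorphism B -> B'}) : {morph tens_map (K := K) h : x y / x * y}.
Proof.
have h0 : tens_map (K := K) h 0 = 0.
  by rewrite -(pure0l K (0 : B)) tens_map_pure pure0l.
elim/tens_ind => [|x x' hx hx'|a c] y; first by rewrite mul0r h0 mul0r.
  by rewrite mulrDl !tens_mapD hx hx' mulrDl.
elim/tens_ind: y => [|y y' hy hy'|a' c']; first by rewrite mulr0 h0 mulr0.
  by rewrite mulrDr !tens_mapD hy hy' mulrDr.
by rewrite pureM !tens_map_pure pureM rmorphM.
Qed.

Lemma tens_map1 (h : {lrmorphism B -> B'}) : tens_map (K := K) h 1 = 1.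
Proof. by rewrite tens_map_pure rmorph1. Qed.

End TensorFunctor.

Section ExtendFunctor.
Variables (F : fieldType) (K : fieldExtType F) (B B' : comAlgType F).
Variable h : {lrmorphism B -> B'}.

Definition extend_map (y : extend K B) : extend K B' := tens_map h y.

Fact extend_map_nmod : nmod_morphism extend_map.
Proof.
split; last exact: tens_mapD.
by rewrite /extend_map -(pure0l K (0 : B)) tens_map_pure pure0l.
Qed.
HB.instance Definition _ :=
  GRing.isNmodMorphism.Build (extend K B) (extend K B') extend_map extend_map_nmod.

Fact extend_map_monoid : monoid_morphism extend_map.
Proof. by split; [exact: tens_map1 | exact: tens_mapM]. Qed.
HB.instance Definition _ :=
  GRing.isMonoidMorphism.Build (extend K B) (extend K B') extend_map extend_map_monoid.

Fact extend_map_scale : scalable extend_map.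
Proof.
by move=> a x; rewrite [LHS]tens_mapM tens_map_pure rmorph1.
Qed.
HB.instance Definition _ :=
  GRing.isScalable.Build K (extend K B) (extend K B') *:%R extend_map extend_map_scale.

End ExtendFunctor.

(** * The inclusion of B in K (x) B and a natural retraction *)

Section ExtendRing.
Variables (F : fieldType) (K : fieldExtType F) (B : comAlgType F).

Definition inr_extend (c : B) : extend K B := pure 1 c.

Fact inr_extend_nmod : nmod_morphism inr_extend.
Proof. by split; [exact: pure0r | exact: pureDr]. Qed.
HB.instance Definition _ :=
  GRing.isNmodMorphism.Build B (extend K B) inr_extend inr_extend_nmod.
Fact inr_extend_monoid : monoid_morphism inr_extend.
Proof. by split=> // c c'; rewrite /inr_extend [RHS]pureM mulr1. Qed.
HB.instance Definition _ :=
  GRing.isMonoidMorphism.Build B (extend K B) inr_extend inr_extend_monoid.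

Lemma extend_algE (z : K) : z%:A = pure z 1 :> extend K B.
Proof. by rewrite [LHS]mulr1. Qed.

Lemma extend_pureE (z : K) (c : B) : pure z c = z%:A * inr_extend c.
Proof. by rewrite extend_algE [RHS]pureM mulr1 mul1r. Qed.

(** Some F-linear functional with value 1 at 1; the family [[tuple 1]] is free but need not span K.
    Any such functional induces a retraction of B -> K (x) B that is natural in B. *)
Definition base_coord : K -> F := coord [tuple (1 : K)] 0.

Lemma base_coord1 : base_coord 1 = 1.
Proof.
rewrite /base_coord; have := @coord_free F K 1 [tuple 1] 0 0.
by rewrite seq1_free => -> //; exact: oner_neq0.
Qed.

Definition inr_section (z : extend K B) : B :=
  \sum_i base_coord (tbase i) *: tcoef z i.

Lemma inr_sectionD : {morph inr_section : x y / x + y}.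
Proof.
move=> x y; rewrite /inr_section -big_split; apply: eq_bigr => i _ /=.
by rewrite tcoefD scalerDr.
Qed.

Lemma inr_section_pure z c : inr_section (pure z c) = base_coord z *: c.
Proof.
rewrite {2}(tbase_sum z) /base_coord linear_sum /= scaler_suml.
apply: eq_bigr => i _; rewrite tcoef_pure linearZ /= mulr_algr !scalerA.
by rewrite mulrC.
Qed.

Lemma inr_extendK : cancel inr_extend inr_section.
Proof. by move=> c; rewrite inr_section_pure base_coord1 scale1r. Qed.

End ExtendRing.

Lemma inr_section_map (F : fieldType) (K : fieldExtType F) (B B' : comAlgType F)
    (h : {lrmorphism B -> B'}) (z : extend K B) :
  inr_section (extend_map h z) = h (inr_section z).
Proof.
elim/tens_ind: z => [|x y hx hy|a c].
- rewrite raddf0; have -> : inr_section (0 : extend K B') = 0.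
    by rewrite -(pure0l K (0 : B')) inr_section_pure scaler0.
  have -> : inr_section (0 : extend K B) = 0.
    by rewrite -(pure0l K (0 : B)) inr_section_pure scaler0.
  by rewrite raddf0.
- by rewrite raddfD !inr_sectionD hx hy raddfD.
- by rewrite [extend_map h _]tens_map_pure !inr_section_pure linearZ.
Qed.
Arguments inr_extend {F} K {B} c.

(** * Conjugation on E and on E (x) A *)

Lemma quadratic_factor (R : comPzRingType) (x y p q : R) :
  (y - x) * (y + x - p) = (y * y - p * y - q) - (x * x - p * x - q).
Proof. by ring. Qed.

Section Quadratic.
Variables (E0 : fieldType) (E : fieldExtType E0) (conj : {lrmorphism E -> E}).
Hypotheses (hE : imaginary_quadratic E) (hconj : is_conjugation conj).

Lemma imaginary_quadratic_natr k : k.+1%:R != 0 :> E0.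
Proof.
case: hE => _ [[[L [f _]] _]|[R [f _]]].
  rewrite -(rmorph_nat f) fmorph_eq0 -scaler_nat scaler_eq0 oner_eq0 orbF.
  by rewrite pnatr_eq0.
by rewrite -(rmorph_nat f) fmorph_eq0 pnatr_eq0.
Qed.

Lemma imaginary_quadratic_natrE k : k.+1%:R != 0 :> E.
Proof.
rewrite -(rmorph_nat (in_alg E)) fmorph_eq0.
exact: imaginary_quadratic_natr.
Qed.

Let nontrivial : exists x : E, conj x != x /\
  forall z : E, exists k l : E0, z = k *: x + l%:A.
Proof.
case: hconj => x hx; exists x; split=> // z.
have fx : free [tuple x; 1].
  rewrite /= free_cons span_seq1 seq1_free oner_neq0 andbT.
  apply: contra hx => /vlineP[k ->].
  by rewrite linearZ /= rmorph1.
have bx : basis_of {:E} [tuple x; 1].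
  by rewrite basisEfree fx subvf /= (proj1 hE).
have := coord_basis bx (memvf z).
rewrite big_ord_recl big_ord1 /= => ->.
by exists (coord [tuple x; 1] ord0 z), (coord [tuple x; 1] (lift ord0 ord0) z).
Qed.

Lemma conj_fixed z : conj z = z -> exists k : E0, z = k%:A.
Proof.
case: nontrivial => x [hx /(_ z)[k [l ->]]].
rewrite linearD !linearZ /= rmorph1 => /addIr /eqP.
rewrite -subr_eq0 -scalerBr scaler_eq0 subr_eq0 (negPf hx) orbF => /eqP ->.
by exists l; rewrite scale0r add0r.
Qed.

(* The conjugate of [x] is the other root of its quadratic polynomial. *)
Let conj_root : exists x : E, [/\ conj x != x, 
  forall z : E, exists k l : E0, z = k *: x + l%:A
  & exists p : E0, conj x = p%:A - x].
Proof.
case: nontrivial => x [hx hz]; exists x; split=> //.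
have [p [q hp]] := hz (x * x); exists p.
have : (conj x - x) * (conj x + x - p%:A) = 0.
  transitivity ((conj x * conj x - p *: conj x - q%:A) - (x * x - p *: x - q%:A)).
    rewrite -(mulr_algl p (conj x)) -(mulr_algl p x); exact: quadratic_factor.
  have -> : conj x * conj x = p *: conj x + q%:A.
    by rewrite -rmorphM hp /= linearP linearZ /= rmorph1.
  have h0 y : p *: y + q%:A - p *: y - q%:A = 0 :> E by rewrite addrAC addrK subrr.
  by rewrite hp !h0 subrr.
move/eqP; rewrite mulf_eq0 subr_eq0 (negPf hx) /= subr_eq0 => /eqP <-.
by rewrite addrK.
Qed.

Lemma conjK z : conj (conj z) = z.
Proof.
have [x [hx /(_ z)[k [l ->]] [p hp]]] := conj_root.
rewrite !linearD !linearZ /= !rmorph1 hp linearB linearZ /= rmorph1 hp.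
by rewrite opprD opprK addrA subrr add0r.
Qed.

Lemma imaginary_element : exists2 theta : E, theta != 0 & conj theta = - theta.
Proof.
have [x [hx _ _]] := conj_root; exists (x - conj x).
  by rewrite subr_eq0 eq_sym.
by rewrite linearB /= conjK opprB.
Qed.

End Quadratic.

Section ConjExtend.
Variables (E0 : fieldType) (E : fieldExtType E0) (conj : {lrmorphism E -> E}).
Variable A : comAlgType E0.

Lemma conj_extend_pure z c : conj_extend conj (pure z c) = pure (conj z) c :> extend E A.
Proof.
rewrite /conj_extend {2}(tbase_sum z) linear_sum pure_suml; apply: eq_bigr => i _.
by rewrite tcoef_pure linearZ pureZ mulr_algr.
Qed.

Fact conj_extend_nmod : nmod_morphism (@conj_extend E0 E conj A).
Proof.
split; first by rewrite -(pure0l E (0 : A)) conj_extend_pure pure0r pure0l.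
move=> x y; rewrite /conj_extend -big_split; apply: eq_bigr => i _ /=.
by rewrite tcoefD pureDr.
Qed.
HB.instance Definition _ := GRing.isNmodMorphism.Build (extend E A) (extend E A)
  (@conj_extend E0 E conj A) conj_extend_nmod.

Fact conj_extend_monoid : monoid_morphism (@conj_extend E0 E conj A).
Proof.
split; first by rewrite conj_extend_pure rmorph1.
elim/tens_ind => [|x x' hx hx'|a c] y; first by rewrite mul0r !raddf0 mul0r.
  by rewrite mulrDl !raddfD /= hx hx' mulrDl.
elim/tens_ind: y => [|y y' hy hy'|a' c']; first by rewrite mulr0 !raddf0 mulr0.
  by rewrite mulrDr !raddfD /= hy hy' mulrDr.
by rewrite [_ * _]pureM !conj_extend_pure [RHS]pureM rmorphM.
Qed.
HB.instance Definition _ := GRing.isMonoidMorphism.Build (extend E A) (extend E A)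
  (@conj_extend E0 E conj A) conj_extend_monoid.

Lemma conj_extend_alg (z : E) : conj_extend conj (z%:A : extend E A) = (conj z)%:A.
Proof. by rewrite !extend_algE conj_extend_pure. Qed.

Lemma conj_extend_inr (c : A) : conj_extend conj (inr_extend E c) = inr_extend E c.
Proof. by rewrite conj_extend_pure rmorph1. Qed.

Hypotheses (hE : imaginary_quadratic E) (hconj : is_conjugation conj).

Lemma conj_extendK : involutive (@conj_extend E0 E conj A).
Proof.
elim/tens_ind => [|x x' hx hx'|a c]; first by rewrite !raddf0.
  by rewrite !raddfD /= hx hx'.
by rewrite !conj_extend_pure (conjK hE hconj).
Qed.

(** A fixed z is half of its trace z + conj z, and the trace of a pure tensor lies in A because
    traces from E lie in E_0. *)
Lemma conj_extend_fixed (z : extend E A) :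
  conj_extend conj z = z -> z = inr_extend E (inr_section z).
Proof.
move=> hz; suff [c ->] : exists c, z = inr_extend E c by rewrite inr_extendK.
suff [c hc] : exists c, z + conj_extend conj z = inr_extend E c.
  exists (2%:R^-1 *: c); rewrite -mulr_algl rmorphM /= -hc hz -mulr2n -(mulr_natl z) mulrA.
  rewrite -(rmorph_nat (inr_extend E)) -rmorphM.
  rewrite mulr_natr -scaler_nat scalerA mulfV ?(imaginary_quadratic_natr hE) //.
  by rewrite scale1r rmorph1 mul1r.
elim/tens_ind: {hz} z => [|x x' [c hc] [c' hc']|a c].
- by exists 0; rewrite !raddf0 addr0.
- by exists (c + c'); rewrite !raddfD /= addrACA hc hc'.
- have [|k hk] := @conj_fixed _ _ _ hE hconj (a + conj a).
    by rewrite linearD /= (conjK hE hconj) addrC.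
  by exists (k *: c); rewrite conj_extend_pure -pureDl hk pureZ.
Qed.

End ConjExtend.

(** * Spinors and the monomial map [star] *)

(** Coefficient comparison in the wedge case of [star_gen]: e is (-1)^i, s an exterior sign, w a
    weight, k a parity factor. *)
Lemma star_left (R : comPzRingType) (w a k s v e : R) : e * e = 1 ->
  w * (e * 2%:R * a) * k * (e * s * v) = a * (2%:R * (s * (w * (k * v)))).
Proof.
move=> he; transitivity ((e * e) * (a * (2%:R * (s * (w * (k * v)))))); first by ring.
by rewrite he mul1r.
Qed.

Lemma star_right (R : comPzRingType) (w a a' k k' s v e : R) : a' * a * k * k' = 1 ->
  w * (2%:R * (e * s * v)) = a' * (s * (w * (e * 2%:R * a) * k * (k' * v))).
Proof.
move=> h; transitivity ((a' * a * k * k') * (w * (2%:R * (e * s * v)))); last by ring.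
by rewrite h mul1r.
Qed.

Section Spinors.
Variables (E0 : fieldType) (E : fieldExtType E0) (n : nat).
Implicit Types (s t : exterior E n) (I J : {set 'I_n}) (r : 'I_(n + n)).

Definition gen r s : exterior E n :=
  match split r with
  | inl i => wedge i s
  | inr i => 2%:R *: interior i s
  end.

Definition dual_index r : 'I_(n + n) :=
  match split r with inl i => rshift n i | inr i => lshift n i end.

Lemma gen_lshift i s : gen (lshift n i) s = wedge i s.
Proof. by rewrite /gen (unsplitK (inl i)). Qed.
Lemma gen_rshift i s : gen (rshift n i) s = 2%:R *: interior i s.
Proof. by rewrite /gen (unsplitK (inr i)). Qed.
Lemma dual_index_lshift i : dual_index (lshift n i) = rshift n i.
Proof. by rewrite /dual_index (unsplitK (inl i)). Qed.
Lemma dual_index_rshift i : dual_index (rshift n i) = lshift n i.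
Proof. by rewrite /dual_index (unsplitK (inr i)). Qed.
Lemma dual_indexK : involutive dual_index.
Proof.
by move=> r; case: (split_ordP r) => i ->;
   rewrite ?dual_index_lshift ?dual_index_rshift ?dual_index_lshift.
Qed.

(** Each i in J turns a wedge product into the action of e_(n + i), twice an interior product: this
    costs 2 a_i and, by [exterior_sign_setC], a sign (-1)^i. The halved exponent charges lambda^-1
    for every second index. *)
Definition star_weight (lam : E0) (a : 'I_(n + n) -> E0) J : E0 :=
  lam ^- #|J|./2 * \prod_(i in J) ((-1) ^+ i * 2%:R * a (lshift n i)).

(** Only the linear part of the antilinear map: the weights lie in E_0, so conjugation commutes with
    it and is composed separately. *)
Definition star lam a s : exterior E n :=
  [ffun I : {set 'I_n} => (star_weight lam a (~: I))%:A * s (~: I)].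

(** The defect caused by the halved exponent, which jumps only when an odd set becomes even. *)
Definition odd_scale (lam : E0) s : exterior E n :=
  [ffun I : {set 'I_n} => (if odd #|I| then lam^-1 else 1)%:A * s I].

(** Exactly i indices lie below i, and they are shared between I and its complement. *)
Lemma exterior_sign_setC i I :
  exterior_sign E i I * exterior_sign E i (~: I) = (-1) ^+ i.
Proof.
rewrite /exterior_sign -exprD; congr (_ ^+ _).
rewrite -cardsUI [X in (_ + #|pred_of_set X|)%N](_ : _ = set0); last first.
  by apply/setP => j; rewrite !inE; case: (j \in I); rewrite ?andbF.
rewrite cards0 addn0 [X in #|pred_of_set X|](_ : _ = [set j : 'I_n | (j < i)%N]); last first.
  by apply/setP => j; rewrite !inE -andb_orl orbN.
rewrite -sum1_card (eq_bigl (fun j : 'I_n => (j < i)%N)); last by move=> j; rewrite inE.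
by rewrite (big_ord_narrow (ltnW (ltn_ord i))) sum1_card card_ord.
Qed.

Lemma exterior_sign_sqr i I : exterior_sign E i I * exterior_sign E i I = 1.
Proof. by rewrite -expr2 /exterior_sign sqrr_sign. Qed.

Lemma exterior_sign_setD1 i I : exterior_sign E i (I :\ i) = exterior_sign E i I.
Proof.
rewrite /exterior_sign; congr (_ ^+ #|pred_of_set _|); apply/setP => j.
by rewrite !inE; case: eqP => //= ->; rewrite ltnn andbF.
Qed.

Lemma exterior_sign_setU1 i I : exterior_sign E i (i |: I) = exterior_sign E i I.
Proof.
rewrite /exterior_sign; congr (_ ^+ #|pred_of_set _|); apply/setP => j.
by rewrite !inE; case: eqP => //= ->; rewrite ltnn andbF.
Qed.

Lemma exterior_signC i I : exterior_sign E i (~: I) = (-1) ^+ i * exterior_sign E i I.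
Proof.
by rewrite -(exterior_sign_setC i I) -mulrA mulrC -mulrA exterior_sign_sqr mulr1.
Qed.

Lemma algM (x y : E0) : (x * y)%:A = x%:A * y%:A :> E.
Proof. exact: (rmorphM (in_alg E)). Qed.

Section Star.
Variables (lam : E0) (a : 'I_(n + n) -> E0).
Hypothesis a_dual : forall i, a (lshift n i) * a (rshift n i) = lam.
Hypothesis lam_neq0 : lam != 0.

Let kappa I : E0 := if odd #|I| then lam^-1 else 1.

Lemma star_weightD1 i J : i \in J ->
  star_weight lam a J =
  star_weight lam a (J :\ i) * ((-1) ^+ i * 2%:R * a (lshift n i)) * kappa (J :\ i).
Proof.
move=> iJ; rewrite /star_weight (bigD1 i) //=.
rewrite [\prod_(_ in J :\ i) _](eq_bigl (fun j => (j \in J) && (j != i))); last first.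
  by move=> j; rewrite !inE andbC.
have -> : lam ^- #|J|./2 = lam ^- #|J :\ i|./2 * kappa (J :\ i).
  rewrite (cardsD1 i J) iJ add1n /kappa -uphalfE uphalf_half.
  by case: odd; rewrite ?mulr1 // add1n exprS invfM mulrC.
by rewrite -[RHS]mulrA [RHS]mulrACA [LHS]mulrACA [kappa _ * _]mulrC.
Qed.

Lemma kappa_setD1 i J : i \in J -> kappa J * kappa (J :\ i) = lam^-1.
Proof.
move=> iJ; rewrite /kappa (cardsD1 i J) iJ /=.
by case: odd; rewrite /= ?mulr1 ?mul1r.
Qed.

(** Complementation exchanges wedge and interior products, so [star] implements e_r |-> a_r e_(r +-
    n) on a single generator, up to the parity factor. *)
Lemma star_gen r s :
  star lam a (gen r s) = (a r)%:A *: gen (dual_index r) (star lam a (odd_scale lam s)).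
Proof.
case: (split_ordP r) => i ->; rewrite ?dual_index_lshift ?dual_index_rshift.
  rewrite gen_lshift gen_rshift; apply/ffunP => I; rewrite !ffunE !inE.
  have [iI|iI] := boolP (i \in I); rewrite /= ?scaler0 ?mulr0 ?scaler0 //.
  have eqI : ~: (i |: I) = ~: I :\ i by apply/setP => j; rewrite !inE negb_or andbC.
  rewrite eqI (@star_weightD1 i (~: I)) ?inE // -/(kappa _).
  rewrite exterior_signC !algM -(in_algE _ (_ ^+ _)) -(in_algE _ 2) rmorphXn rmorphN1.
  rewrite rmorph_nat /=; set e := (-1) ^+ i; have ee : e * e = 1 by rewrite -expr2 sqrr_sign.
  exact: star_left.
rewrite gen_rshift gen_lshift; apply/ffunP => I; rewrite !ffunE !inE.
have [iI|iI] := boolP (i \in I); rewrite /= ?scaler0 ?mulr0 ?scaler0 //.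
have eqI : i |: ~: I = ~: (I :\ i).
  by apply/setP => j; rewrite !inE negb_and negbK orbC.
rewrite eqI -[if _ then _ else _]/(kappa _).
have -> : ~: I = ~: (I :\ i) :\ i.
  by apply/setP => j; rewrite !inE; case: eqP => // ->; rewrite iI.
rewrite (@star_weightD1 i (~: (I :\ i))) ?inE ?eqxx // exterior_sign_setD1 exterior_signC.
rewrite exterior_sign_setD1.
set J := ~: (I :\ i); have hJ : a (rshift n i) * a (lshift n i) * kappa (J :\ i) * kappa J = 1.
  rewrite -!mulrA (mulrC (kappa _)) kappa_setD1 ?inE ?eqxx // mulrA (mulrC (a _)).
  by rewrite a_dual mulfV.
move: (congr1 (in_alg E) hJ); rewrite rmorph1 /= !algM -(in_algE _ (_ ^+ _)).
rewrite -(in_algE _ 2) rmorphXn rmorphN1 rmorph_nat /= => hJE.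
exact: star_right.
Qed.

End Star.
End Spinors.

Lemma regular_scaleE (R : pzRingType) (k x : R) : k *: (x : R^o) = k * x.
Proof. by []. Qed.

(** * Parity, the dot product and blocks of operators on S^p *)

Section SpinorOperators.
Variables (E0 : fieldType) (E : fieldExtType E0) (n : nat).
Implicit Types (s t : exterior E n) (I J : {set 'I_n}) (r q : 'I_(n + n)).

Fact gen_linear r : linear (@gen E0 E n r).
Proof.
move=> k s t; case: (split_ordP r) => i ->; rewrite ?gen_lshift ?gen_rshift;
  apply/ffunP => I; rewrite !ffunE !regular_scaleE; case: (i \in I); by ring.
Qed.
HB.instance Definition _ r := GRing.isLinear.Build E (exterior E n) (exterior E n) *:%R
  (@gen E0 E n r) (gen_linear r).

Fact star_linear lam a : linear (@star E0 E n lam a).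
Proof.
by move=> k s t; apply/ffunP => I; rewrite !ffunE !regular_scaleE; ring.
Qed.
HB.instance Definition _ lam a :=
  GRing.isLinear.Build E (exterior E n) (exterior E n) *:%R
  (@star E0 E n lam a) (star_linear lam a).

Definition supported (p : bool) s := forall I, odd #|I| != p -> s I = 0.

Lemma supported_basis p J : odd #|J| = p -> supported p (exterior_basis E J).
Proof. by move=> hJ I; rewrite ffunE; case: (I =P J) => [->|//]; rewrite hJ eqxx. Qed.

Lemma gen_supported p r s : supported p s -> supported (~~ p) (gen r s).
Proof.
rewrite /supported => hs I hI; case: (split_ordP r) => i ->;
  rewrite ?gen_lshift ?gen_rshift !ffunE.
  have [iI|//] := boolP (i \in I); rewrite hs ?mulr0 //.
  by move: hI; rewrite (cardsD1 i I) iI /=; case: odd; case: p {hs}.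
have [iI|iI] := boolP (i \in I); rewrite ?scaler0 //.
rewrite hs ?mulr0 ?scaler0 //.
by move: hI; rewrite cardsU1 iI /=; case: odd; case: p {hs}.
Qed.

Lemma star_supported p lam a s : ~~ odd n -> supported p s -> supported p (star lam a s).
Proof.
rewrite /supported => ne hs I hI; rewrite ffunE hs ?mulr0 //.
have hc : odd n = odd #|I| (+) odd #|~: I| by rewrite -oddD cardsC card_ord.
by move: ne hI; rewrite hc; do 2!case: odd; case: p {hs}.
Qed.

(** A generator flips the parity, so scaling the odd part by lambda^-1 after it is lambda^-1 times
    scaling the odd part by lambda before it. *)
Lemma odd_scale_gen lam r s : lam != 0 ->
  odd_scale lam (gen r s) = (lam^-1)%:A *: gen r (odd_scale lam^-1 s).
Proof.
move=> hl; have hE : (lam%:A : E) != 0 by rewrite -in_algE fmorph_eq0.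
have hlV : lam^-1%:A = lam%:A^-1 :> E by rewrite -!in_algE fmorphV.
case: (split_ordP r) => i ->; rewrite ?gen_lshift ?gen_rshift;
  apply/ffunP => I; rewrite !ffunE !regular_scaleE;
  have [iI|iI] := boolP (i \in I); rewrite ?mulr0 //.
  rewrite (cardsD1 i I) iI /=.
  by case: odd => /=; rewrite ?invrK ?hlV !scale1r; field.
rewrite cardsU1 iI /=.
by case: odd => /=; rewrite ?invrK ?hlV !scale1r; field.
Qed.

Lemma odd_scaleK lam s : lam != 0 -> odd_scale lam (odd_scale lam^-1 s) = s.
Proof.
move=> hl; apply/ffunP => I; rewrite !ffunE mulrA -algM.
by case: odd; rewrite ?invrK ?mulVf // ?mulr1 scale1r mul1r.
Qed.

(** The parity factors of the two generators combine into the single scalar lambda^-1. *)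
Lemma star_gen2 lam a r q s :
  (forall i, a (lshift n i) * a (rshift n i) = lam) -> lam != 0 ->
  star lam a (gen r (gen q s)) =
  (lam^-1 * a r * a q)%:A *: gen (dual_index r) (gen (dual_index q) (star lam a s)).
Proof.
move=> ha hl; rewrite (star_gen ha hl) (odd_scale_gen _ _ hl) linearZ /= (star_gen ha hl).
rewrite odd_scaleK // !linearZ /= !scalerA -!algM.
by congr (_%:A *: _); ring.
Qed.

Definition dot s t : E := \sum_I s I * t I.

Lemma dotC s t : dot s t = dot t s.
Proof. by apply: eq_bigr => I _; rewrite mulrC. Qed.

Lemma dotDl s s' t : dot (s + s') t = dot s t + dot s' t.
Proof. by rewrite -big_split; apply: eq_bigr => I _ /=; rewrite ffunE mulrDl. Qed.

Lemma dotZl k s t : dot (k *: s) t = k * dot s t.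
Proof. by rewrite big_distrr; apply: eq_bigr => I _ /=; rewrite ffunE -mulrA. Qed.

Lemma dot_wedge i s t : dot (wedge i s) t = dot s (interior i t).
Proof.
rewrite /dot (bigID (fun I => i \in I)) /= [X in _ + X]big1 ?addr0; last first.
  by move=> I hI; rewrite !ffunE (negPf hI) mul0r.
rewrite [RHS](bigID (fun I => i \notin I)) /= [X in _ = _ + X]big1 ?addr0; last first.
  by move=> I; rewrite negbK => hI; rewrite !ffunE hI mulr0.
rewrite (reindex_onto (fun I => i |: I) (fun I => I :\ i)) /=; last first.
  by move=> I hI; rewrite setD1K.
have hIi I : (i \in i |: I) && ((i |: I) :\ i == I) = (i \notin I).
  rewrite setU11 /=; apply/eqP/idP => [<-|/setU1K //]; by rewrite setD11.
apply: eq_big => [|I]; first exact: hIi.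
rewrite hIi => iI; rewrite !ffunE setU11 setU1K // (negPf iI) exterior_sign_setU1.
by rewrite [_ * s I]mulrC [RHS]mulrA.
Qed.

(** The transpose of e_i is half of e_(n + i), since the latter acts by twice the interior
    product. *)
Lemma dot_gen a r s t :
  (forall i : 'I_n, a (lshift n i) = 2%:R^-1 /\ a (rshift n i) = 2%:R) -> 2%:R != 0 :> E0 ->
  dot (gen r s) t = dot s ((a r)%:A *: gen (dual_index r) t).
Proof.
move=> ha h2; have h2E : 2%:R%:A = 2%:R :> E by rewrite -in_algE rmorph_nat.
case: (split_ordP r) => i ->; have [al ar] := ha i;
  rewrite ?dual_index_lshift ?dual_index_rshift ?gen_lshift ?gen_rshift.
  by rewrite al -h2E scalerA -algM mulVf // !scale1r dot_wedge.
by rewrite ar h2E dotZl dotC -dot_wedge [in RHS]dotC dotZl dotC.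
Qed.

(** The block of U on spinors of parity p; composition becomes the matrix product once the inner
    operator preserves the parity. *)
Definition spin_mx p (U : exterior E n -> exterior E n) : 'M[E]_#|half_index n p| :=
  \matrix_(i, j) U (exterior_basis E (enum_val j)) (enum_val i).

Lemma half_indexP p (i : 'I_#|half_index n p|) : odd #|enum_val i| = p.
Proof. by have := enum_valP i; rewrite inE => /eqP. Qed.

Lemma supported_sum p s : supported p s ->
  s = \sum_(i < #|half_index n p|) s (enum_val i) *: exterior_basis E (enum_val i).
Proof.
rewrite /supported => hs; rewrite -(big_enum_val (fun I => s I *: exterior_basis E I)).
apply/ffunP => I; rewrite sum_ffunE; have [hI|hI] := eqVneq (odd #|I|) p.
  rewrite (bigD1 I) ?inE ?hI //= big1 ?addr0; last first.
    by move=> J /andP[_ JI]; rewrite !ffunE eq_sym (negPf JI) scaler0.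
  by rewrite !ffunE eqxx regular_scaleE mulr1.
rewrite hs // big1 // => J; rewrite inE !ffunE => /eqP hJ.
by case: eqP => [IJ|_]; rewrite ?scaler0 //; move: hI; rewrite IJ hJ eqxx.
Qed.

Lemma spin_mxM p (U : {linear exterior E n -> exterior E n}) V :
  (forall s, supported p s -> supported p (V s)) ->
  spin_mx p (fun s => U (V s)) = spin_mx p U *m spin_mx p V.
Proof.
move=> hV; apply/matrixP => i j; rewrite !mxE.
have := hV _ (supported_basis (half_indexP j)) => /supported_sum ->.
rewrite linear_sum sum_ffunE; apply: eq_bigr => k _.
by rewrite linearZ !mxE ffunE mulrC.
Qed.

End SpinorOperators.

(** * The commutant of the half spin representation *)

Section Commutant.
Variables (E0 : fieldType) (E : fieldExtType E0) (n : nat) (p : bool).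
Implicit Types (s t : exterior E n) (I J : {set 'I_n}) (r q : 'I_(n + n)).
Implicit Type U : exterior E n -> exterior E n.

Lemma exteriorB s t I : (s - t) I = s I - t I.
Proof. by rewrite !ffunE. Qed.

(** Commutators rather than products: they represent elements of so(W), which is what infinitesimal
    points provide. *)
Definition gen_comm r q s : exterior E n := gen r (gen q s) - gen q (gen r s).

Definition toggle (i : 'I_n) I := if i \in I then I :\ i else i |: I.

Lemma in_toggle i j I : (j \in toggle i I) = (j == i) (+) (j \in I).
Proof.
rewrite /toggle; case: ifP => iI; rewrite !inE; case: (j =P i) => [->|_] //=;
  by rewrite iI.
Qed.

Lemma odd_toggle i I : odd #|toggle i I| = ~~ odd #|I|.
Proof.
rewrite /toggle; case: ifP => iI; last by rewrite cardsU1 iI.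
by rewrite [in RHS](cardsD1 i I) iI /= negbK.
Qed.

(** The vector e_i + e_(n + i)/2 has square 1 in the Clifford algebra and toggles the index i in
    every basis spinor, up to sign. *)
Definition flip i s : exterior E n := gen (lshift n i) s + 2%:R^-1 *: gen (rshift n i) s.

Hypothesis two_neq0 : 2%:R != 0 :> E.

Lemma flipE i s I : flip i s I = exterior_sign E i I * s (toggle i I).
Proof.
rewrite /flip gen_lshift gen_rshift scalerA mulVf // scale1r !ffunE /toggle.
by case: ifP; rewrite ?addr0 ?add0r.
Qed.

Definition flip_comm i j s : exterior E n := flip i (flip j s) - flip j (flip i s).

Lemma flip_commE i j s : flip_comm i j s =
  gen_comm (lshift n i) (lshift n j) s + 2%:R^-1 *: gen_comm (lshift n i) (rshift n j) s
  + 2%:R^-1 *: gen_comm (rshift n i) (lshift n j) s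
  + (2%:R^-1 * 2%:R^-1) *: gen_comm (rshift n i) (rshift n j) s.
Proof.
rewrite /flip_comm /flip /gen_comm !linearD !linearZ /= ?scalerDr ?scalerN -?scalerA.
apply/ffunP => I; rewrite !ffunE; by ring.
Qed.

Lemma exterior_sign_toggle i j I : i != j ->
  exterior_sign E j (toggle i I) = exterior_sign E j I * (-1) ^+ (i < j)%N.
Proof.
move=> ij; rewrite /exterior_sign /toggle; case: ifP => iI.
  rewrite [in RHS](cardsD1 i) !inE iI /=.
  have -> : [set j0 in I | (j0 < j)%N] :\ i = [set j0 in I :\ i | (j0 < j)%N].
    by apply/setP => k; rewrite !inE andbA.
  by rewrite exprD mulrAC -expr2 sqrr_sign mul1r.
have [lij|lij] := boolP (i < j)%N; last first.
  rewrite mulr1; congr (_ ^+ #|pred_of_set _|); apply/setP => k; rewrite !inE.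
  by case: eqP => // ->; rewrite (negPf lij) !andbF.
have -> : [set j0 in i |: I | (j0 < j)%N] = i |: [set j0 in I | (j0 < j)%N].
  by apply/setP => k; rewrite !inE; case: eqP => // ->; rewrite lij.
by rewrite cardsU1 !inE iI /= exprD mulrC.
Qed.

(** Distinct flips anticommute, so their commutator is twice their product: a monomial operator with
    invertible coefficients. *)
Lemma flip_commE2 i j s I : i != j ->
  flip_comm i j s I = (2%:R * (-1) ^+ (i < j)%N * exterior_sign E i I * exterior_sign E j I)
    * s (toggle i (toggle j I)).
Proof.
move=> ij; have tC : toggle j (toggle i I) = toggle i (toggle j I).
  by apply/setP => k; rewrite !in_toggle !addbA (addbC (k == i)).
have fE k l : flip k (flip l s) I =
    exterior_sign E k I * (exterior_sign E l (toggle k I) * s (toggle l (toggle k I))).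
  exact: etrans (flipE _ _ _) (congr1 _ (flipE _ _ _)).
have -> := etrans (exteriorB _ _ _) (congr2 (fun u v : E => u - v) (fE i j) (fE j i)).
rewrite tC.
rewrite (exterior_sign_toggle _ ij) (exterior_sign_toggle (i := j)) 1?eq_sym //.
have -> : (-1) ^+ (j < i)%N = - (-1) ^+ (i < j)%N :> E.
  by move: ij; rewrite -val_eqE /=; case: ltngtP => //= _ _; rewrite ?opprK.
by ring.
Qed.

Lemma gen_comm_number i s I :
  gen_comm (lshift n i) (rshift n i) s I = (if i \in I then 2%:R else - 2%:R) * s I.
Proof.
rewrite exteriorB !gen_lshift !gen_rshift !ffunE !inE eqxx.
have [iI|iI] := boolP (i \in I) => /=.
  rewrite scaler0 subr0 exterior_sign_setD1 setD1K // regular_scaleE mulrCA.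
  by congr (_ * _); rewrite mulrA exterior_sign_sqr mul1r.
rewrite exterior_sign_setU1 setU1K // mulrA exterior_sign_sqr mul1r regular_scaleE.
by rewrite sub0r mulNr.
Qed.

Lemma half_enum J : odd #|J| = p -> exists x : 'I_#|half_index n p|, enum_val x = J.
Proof.
move=> hJ; have hin : J \in half_index n p by rewrite inE hJ.
by exists (enum_rank_in hin J); rewrite enum_rankK_in.
Qed.

Lemma spin_mxD U V :
  spin_mx p (fun s => U s + V s) = spin_mx p U + spin_mx p V.
Proof. by apply/matrixP => x y; rewrite !mxE ffunE. Qed.

Lemma spin_mxZ k U : spin_mx p (fun s => k *: U s) = k *: spin_mx p U.
Proof. by apply/matrixP => x y; rewrite !mxE ffunE. Qed.

Lemma basis_enum_val (x y : 'I_#|half_index n p|) :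
  exterior_basis E (enum_val y) (enum_val x) = (x == y)%:R.
Proof. by rewrite ffunE (inj_eq enum_val_inj). Qed.

Section Scalar.
Variables (B : comPzRingType) (h : {rmorphism E -> B}) (Z : 'M[B]_#|half_index n p|).
Hypothesis n_gt0 : (0 < n)%N.

Let commutes U := map_mx h (spin_mx p U) *m Z = Z *m map_mx h (spin_mx p U).
Hypothesis Zcomm : forall r q, commutes (gen_comm r q).

Let commutesD U V : commutes U -> commutes V -> commutes (fun s => U s + V s).
Proof. by rewrite /commutes spin_mxD map_mxD mulmxDl mulmxDr => -> ->. Qed.

Let commutesZ k U : commutes U -> commutes (fun s => k *: U s).
Proof.
by rewrite /commutes spin_mxZ map_mxZ -scalemxAl -scalemxAr => ->.
Qed.

Let commutes_flip i j : commutes (flip_comm i j).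
Proof.
have -> : flip_comm i j = fun s =>
  gen_comm (lshift n i) (lshift n j) s + 2%:R^-1 *: gen_comm (lshift n i) (rshift n j) s
  + 2%:R^-1 *: gen_comm (rshift n i) (lshift n j) s
  + (2%:R^-1 * 2%:R^-1) *: gen_comm (rshift n i) (rshift n j) s.
  by apply/funext => s; exact: flip_commE.
by do 3!(apply: commutesD; last by apply: commutesZ; exact: Zcomm).
Qed.

(** B may have zero divisors, so only images of nonzero elements of E are cancelled. *)
Let unit_cancel (k : E) (z z' : B) : k != 0 -> h k * z = h k * z' -> z = z'.
Proof.
move=> k0 /(congr1 ( *%R (h k^-1))).
by rewrite !mulrA -rmorphM mulVf // rmorph1 !mul1r.
Qed.

(** Take i in exactly one of the two index sets: the commutator of e_i and e_(n + i) is diagonal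
    with eigenvalues 2 and -2 there, and their difference is invertible. *)
Lemma commutant_diag x y : x != y -> Z x y = 0.
Proof.
move=> xy; have [i hi] : exists i, (i \in enum_val x) != (i \in enum_val y).
  apply: contrapT => hn; case/negP: xy; apply/eqP/enum_val_inj/setP => i.
  by apply/eqP/negPn/negP => hi; apply: hn; exists i.
pose nu (z : 'I_#|half_index n p|) : E := if i \in enum_val z then 2%:R else - 2%:R.
have hN : spin_mx p (gen_comm (lshift n i) (rshift n i)) = diag_mx (\row_z nu z).
  apply/matrixP => u v; rewrite !mxE gen_comm_number basis_enum_val.
  exact: mulr_natr.
have := Zcomm (lshift n i) (rshift n i); rewrite /commutes hN map_diag_mx => /matrixP/(_ x y).
rewrite mul_diag_mx mul_mx_diag !mxE mulrC => /eqP; rewrite -subr_eq0 -mulrBr -rmorphB => /eqP h0.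
apply: (@unit_cancel (nu x - nu y)); last by rewrite mulrC h0 mulr0.
rewrite /nu; move: hi; case: ifP => _; case: ifP => _ // _.
  by rewrite opprK -natrD (_ : (2 + 2 = 2 * 2)%N) // natrM mulf_neq0.
by rewrite -opprD oppr_eq0 -natrD (_ : (2 + 2 = 2 * 2)%N) // natrM mulf_neq0.
Qed.

Lemma commutant_toggle i j x y : i != j ->
  enum_val y = toggle i (toggle j (enum_val x)) -> Z x x = Z y y.
Proof.
move=> ij hy.
pose c : E := 2%:R * (-1) ^+ (i < j)%N * exterior_sign E i (enum_val x)
    * exterior_sign E j (enum_val x).
have hC z : map_mx h (spin_mx p (flip_comm i j)) x z = h (c * (z == y)%:R).
  by rewrite !mxE flip_commE2 // -hy basis_enum_val eq_sym.
have := commutes_flip i j => /matrixP/(_ x y); rewrite !mxE.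
rewrite (bigD1 y) //= big1 ?addr0; last by move=> z zy; rewrite hC (negPf zy) mulr0 rmorph0 mul0r.
rewrite (bigD1 x) //= big1 ?addr0; last by move=> z zx; rewrite commutant_diag 1?eq_sym // mul0r.
rewrite !hC eqxx mulr1 [RHS]mulrC => /esym; apply: unit_cancel.
by rewrite !mulf_neq0 // ?signr_eq0.
Qed.

(* The commutators of [e_i] and [e_(n + i)] act diagonally with distinct joint *)
(* eigenvalues, and the [flip_comm i j] permute their eigenlines transitively. *)
Lemma commutant_scalar : exists z, Z = z%:M.
Proof.
pose i0 := Ordinal n_gt0.
have [x0 hx0] : exists x0 : 'I_#|half_index n p|, enum_val x0 = if p then [set i0] else set0.
  by apply: half_enum; case: p; rewrite ?cards1 ?cards0.
exists (Z x0 x0); apply/matrixP => x y; rewrite !mxE.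
have [<-|xy] := eqVneq x y; last by rewrite commutant_diag.
(* Toggling i together with i0 keeps the parity and removes i, so the part of the set away from i0
   shrinks; once it is empty, the parity p decides whether i0 belongs to the set. *)
rewrite mulr1n {y}; have [k] := ubnP #|enum_val x :\ i0|.
elim: k x => // k IH x; rewrite ltnS => hk.
have [e0|[i hi]] := set_0Vmem (enum_val x :\ i0).
  suff -> : x = x0 by [].
  apply: enum_val_inj; rewrite hx0.
  have hp : (i0 \in enum_val x) = p.
    by rewrite -[RHS](half_indexP x) (cardsD1 i0 (enum_val x)) e0 cards0 addn0 oddb.
  have hJ j : (j \in if p then [set i0] else set0) = (j == i0) && p.
    by case: (p); rewrite ?inE ?andbT ?andbF.
  apply/setP => j; rewrite hJ; move/setP/(_ j): e0; rewrite !inE.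
  by case: (j =P i0) => [->|_].
have [ii0 iX] : i != i0 /\ i \in enum_val x by move: hi; rewrite !inE => /andP.
have hodd : odd #|toggle i (toggle i0 (enum_val x))| = p.
  by rewrite !odd_toggle negbK half_indexP.
have [y hy] := half_enum hodd; rewrite (commutant_toggle ii0 hy); apply: IH; rewrite hy.
have -> : toggle i (toggle i0 (enum_val x)) :\ i0 = enum_val x :\ i0 :\ i.
  apply/setP => j; rewrite !inE !in_toggle.
  by case: (j =P i) => [->|_]; case: eqP => //= _; rewrite ?iX // -?in_set0 ?andbF.
by move: hk; rewrite (cardsD1 i (_ :\ i0)) hi.
Qed.

End Scalar.
End Commutant.

(** * Half spin representations on points *)

Section SpinModule.
Variables (E0 : fieldType) (E : fieldExtType E0) (W : vectType E) (n : nat).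
Variables (e : (n + n).-tuple W) (C : falgType E) (iota : {linear W -> C}).
Variable act : C -> {linear exterior E n -> exterior E n}.
Hypotheses (he : basis_of fullv e) (hact : is_spin_module iota e act).
Implicit Types (s t : exterior E n) (r q : 'I_(n + n)) (p : bool).

Lemma act_gen r s : act (iota (tnth e r)) s = gen r s.
Proof.
by case: (split_ordP r) => i ->;
  rewrite ?gen_lshift ?gen_rshift ?(sm_wedge hact) ?(sm_interior hact).
Qed.

Lemma act_iota w s : act (iota w) s = \sum_r coord e r w *: gen r s.
Proof.
have act0 : act 0 s = 0 by rewrite -[X in act X](scale0r (0 : C)) (sm_scale hact) scale0r.
rewrite {1}(coord_basis he (memvf w)) linear_sum /=.
rewrite (big_morph (fun c => act c s) (id1 := 0) (op1 := +%R)) //; last first.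
  by move=> x y; rewrite (sm_add hact).
by apply: eq_bigr => r _; rewrite linearZ /= (sm_scale hact) -tnth_nth act_gen.
Qed.

Lemma supported_sum_scale p (I : finType) (k : I -> E) (f : I -> exterior E n) :
  (forall i, supported p (f i)) -> supported p (\sum_i k i *: f i).
Proof.
move=> hf J hJ; rewrite sum_ffunE big1 // => i _.
by rewrite ffunE hf // scaler0.
Qed.

Lemma act_word_supported p (l : seq W) s : supported p s ->
  supported (p (+) odd (size l)) (act (\prod_(w <- l) iota w) s).
Proof.
move=> hs; elim: l => [|w l IH]; first by rewrite big_nil (sm_one hact) addbF.
rewrite big_cons (sm_mul hact) act_iota /= addbN; apply: supported_sum_scale => r.
exact: gen_supported.
Qed.

Definition rho p (c : C) := spin_mx p (act c).

Fact rho_linear p : linear (rho p).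
Proof.
move=> k c c'; apply/matrixP => x y.
by rewrite !mxE (sm_add hact) (sm_scale hact) !ffunE.
Qed.
HB.instance Definition _ p := GRing.isLinear.Build E C 'M[E]_#|half_index n p| *:%R
  (rho p) (rho_linear p).

Lemma rhoD p : {morph rho p : x y / x + y}.
Proof. exact: linearD. Qed.

Lemma rhoB p : {morph rho p : x y / x - y}.
Proof. exact: linearB. Qed.

Lemma rhoZ p k c : rho p (k *: c) = k *: rho p c.
Proof. by rewrite linearZ. Qed.

Lemma rho1 p : rho p 1 = 1%:M.
Proof. by apply/matrixP => x y; rewrite !mxE (sm_one hact) basis_enum_val. Qed.

(** An odd right factor would leave S^p, where the block [rho] no longer sees it. *)
Lemma rhoM p c (l : seq W) : ~~ odd (size l) ->
  rho p (c * \prod_(w <- l) iota w) = rho p c *m rho p (\prod_(w <- l) iota w).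
Proof.
move=> hl; rewrite -spin_mxM.
  by apply/matrixP => x y; rewrite !mxE (sm_mul hact).
by move=> s hs; have := @act_word_supported p l s hs; rewrite (negPf hl) addbF.
Qed.

Definition gen2_mx p r q : 'M[E]_#|half_index n p| := spin_mx p (fun s => gen r (gen q s)).

Lemma rho_gen2 p r q : rho p (iota (tnth e r) * iota (tnth e q)) = gen2_mx p r q.
Proof. by apply/matrixP => x y; rewrite !mxE (sm_mul hact) !act_gen. Qed.

Section HalfSpin.
Variables (A : comAlgType E0) (p : bool).
Let B := extend E A.
Let toB d (M : 'M[E]_d) : 'M[B]_d := map_mx (in_alg B) M.

Lemma half_spinE (x : point C A) :
  half_spin act p x = \sum_k tcoef x k *: toB (rho p (tbase k)).
Proof.
apply/matrixP => i j; rewrite mxE summxE; apply: eq_bigr => k _.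
by rewrite !mxE.
Qed.

Lemma half_spin_pure c (y : B) : half_spin act p (pure c y : point C A) = y *: toB (rho p c).
Proof.
rewrite half_spinE {2}(tbase_sum c) linear_sum /= /toB raddf_sum scaler_sumr.
apply: eq_bigr => k _; rewrite tcoef_pure linearZ /= map_mxZ scalerA.
by [].
Qed.

Lemma half_spinD (x y : point C A) :
  half_spin act p (x + y) = half_spin act p x + half_spin act p y.
Proof.
rewrite !half_spinE -big_split; apply: eq_bigr => k _ /=.
by rewrite tcoefD scalerDl.
Qed.

Lemma half_spin0 : half_spin act p (0 : point C A) = 0.
Proof. by rewrite -(pure0l C (0 : B)) half_spin_pure scale0r. Qed.

Lemma half_spin_sum I (s : seq I) (f : I -> point C A) :
  half_spin act p (\sum_(i <- s) f i) = \sum_(i <- s) half_spin act p (f i).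
Proof.
elim: s => [|i s IH]; first by rewrite !big_nil half_spin0.
by rewrite !big_cons half_spinD IH.
Qed.

Lemma half_spin1 : half_spin act p (1 : point C A) = 1%:M.
Proof. by rewrite half_spin_pure rho1 scale1r /toB map_mx1. Qed.

Lemma half_spinM (x : point C A) (s : seq (B * seq W)) : even_expr s ->
  half_spin act p (x * clifford_expr iota s) =
  half_spin act p x *m half_spin act p (clifford_expr iota s : point C A).
Proof.
move=> /allP hs; rewrite /clifford_expr mulr_sumr !half_spin_sum mulmx_sumr.
apply: eq_big_seq => t /hs ht.
elim/tens_ind: x => [|x x' hx hx'|c y].
- by rewrite mul0r half_spin0 mul0mx.
- by rewrite mulrDl !half_spinD hx hx' mulmxDl.
- rewrite pureM !half_spin_pure rhoM // /toB map_mxM -scalemxAl -scalemxAr scalerA.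
  by [].
Qed.

(** A single generator exchanges S^+ and S^-, so the covering relation is transported through
    products of two. *)
Lemma half_spin_covers (x : point C A) (s : seq (B * seq W)) (g : 'M[B]_(n + n)) :
  even_expr s -> x = clifford_expr iota s -> covers e iota x g -> forall r q,
  half_spin act p x *m toB (gen2_mx p r q) =
  (\sum_j \sum_k (g r j * g q k) *: toB (gen2_mx p j k)) *m half_spin act p x.
Proof.
move=> hs hx hg r q; rewrite -rho_gen2.
have -> : half_spin act p x *m toB (rho p (iota (tnth e r) * iota (tnth e q))) =
    half_spin act p (x * pure (iota (tnth e r) * iota (tnth e q)) 1).
  have := @half_spinM x [:: (1, [:: tnth e r; tnth e q])] isT.
  by rewrite /clifford_expr big_seq1 /= !big_cons big_nil mulr1 half_spin_pure scale1r.
have -> : x * pure (iota (tnth e r) * iota (tnth e q)) 1 =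
   (\sum_j \sum_k pure (iota (tnth e j) * iota (tnth e k)) (g r j * g q k)) * x.
  rewrite -[1 in LHS]mulr1 -pureM mulrA hg -mulrA hg mulrA; congr (_ * x).
  rewrite mulr_suml; apply: eq_bigr => j _; rewrite mulr_sumr; apply: eq_bigr => k _.
  by rewrite pureM.
rewrite {1}hx half_spinM // -hx half_spin_sum; congr (_ *m _).
apply: eq_bigr => j _; rewrite half_spin_sum; apply: eq_bigr => k _.
by rewrite half_spin_pure rho_gen2.
Qed.

End HalfSpin.

Lemma half_spin_map p (A A' : comAlgType E0) (h : {lrmorphism A -> A'}) (x : point C A) :
  half_spin act p (point_map h x) = map_mx (extend_map h) (half_spin act p x).
Proof.
rewrite /point_map /tens_map half_spin_sum half_spinE.
rewrite raddf_sum; apply: eq_bigr => k _.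
rewrite half_spin_pure /= map_mxZ -map_mx_comp; congr (_ *: _).
apply/matrixP => i j; rewrite !mxE /=; symmetry.
rewrite linearZ rmorph1.
by [].
Qed.

End SpinModule.

(** * The square of [star] and the invariant bilinear form *)

Section StarMatrix.
Variables (E0 : fieldType) (E : fieldExtType E0) (n : nat).
Implicit Types (s t : exterior E n) (I J : {set 'I_n}) (r q : 'I_(n + n)) (p : bool).
Hypothesis n_even : ~~ odd n.

Definition star_mx (lam : E0) (a : 'I_(n + n) -> E0) p : 'M[E]_#|half_index n p| :=
  spin_mx p (star lam a).

Lemma gen2_supported r q p s : supported p s -> supported p (gen r (gen q s)).
Proof.
by move=> hs; have := gen_supported r (gen_supported q hs); rewrite negbK.
Qed.

Lemma star_mx_gen2 lam a p r q :
  (forall i, a (lshift n i) * a (rshift n i) = lam) -> lam != 0 ->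
  star_mx lam a p *m gen2_mx E p r q =
  (lam^-1 * a r * a q)%:A *: (gen2_mx E p (dual_index r) (dual_index q) *m star_mx lam a p).
Proof.
move=> ha hl; rewrite -(spin_mxM (star lam a)); last exact: gen2_supported.
rewrite -(spin_mxM (gen (dual_index r) \o gen (dual_index q))); last first.
  by move=> s; exact: star_supported.
rewrite -spin_mxZ; apply/matrixP => x y; rewrite !mxE.
by rewrite /= star_gen2.
Qed.

(** As n is even, J and its complement have the same parity; when both are odd, the two roundings
    together lose one factor lambda^-1. *)
Lemma star_weight_setC lam (a : 'I_(n + n) -> E0) J :
  star_weight lam a J * star_weight lam a (~: J) =
  lam ^- (n./2 - odd #|J|) * \prod_(i < n) ((-1) ^+ i * 2%:R * a (lshift n i)).
Proof.
rewrite /star_weight mulrACA -invfM -exprD; congr (_^-1 * _).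
  congr (_ ^+ _); have hc : (#|J| + #|~: J| = n)%N by rewrite cardsC card_ord.
  have : odd #|~: J| = odd #|J|.
    by move: n_even; rewrite -{1}hc oddD; do 2!case: odd.
  move=> ho; have := odd_double_half #|J|; have := odd_double_half #|~: J|.
  have := odd_double_half n; rewrite ho (negPf n_even) add0n -{4}hc; lia.
rewrite [RHS](bigID (fun i => i \in J)) /=; congr (_ * _).
by apply: eq_bigl => i; rewrite inE.
Qed.

(** The constant c_p. The boolean p is read as 0 or 1, so for n = 2m the exponent of lambda^-1 is m
    on S^+ and m - 1 on S^-. *)
Definition star_sqr lam (a : 'I_(n + n) -> E0) p : E0 :=
  lam ^- (n./2 - p) * \prod_(i < n) ((-1) ^+ i * 2%:R * a (lshift n i)).

Lemma star_mx_sqr lam a p : star_mx lam a p *m star_mx lam a p = ((star_sqr lam a p)%:A)%:M.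
Proof.
rewrite -(spin_mxM (star lam a)); last by move=> s; exact: star_supported.
apply/matrixP => x y; rewrite mxE mxE ffunE ffunE setCK basis_enum_val mulrA -algM mulrC.
rewrite mulr_natl [X in X%:A]mulrC star_weight_setC half_indexP.
by [].
Qed.

Lemma star_basis lam a J I :
  star lam a (exterior_basis E J) I = (star_weight lam a J)%:A * (J == ~: I)%:R.
Proof. by rewrite !ffunE eq_sym; case: eqP => [->|_]; rewrite ?mulr0. Qed.

(* Wedge and interior products are transposed to each other, so [star] for *)
(* these weights intertwines each generator with its transpose.            *)
Definition transpose_weight r : E0 :=
  match split r with inl _ => 2%:R^-1 | inr _ => 2%:R end.

Hypothesis two_neq0 : 2%:R != 0 :> E0.

Lemma transpose_weightP (i : 'I_n) :
  transpose_weight (lshift n i) = 2%:R^-1 /\ transpose_weight (rshift n i) = 2%:R.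
Proof. by rewrite /transpose_weight (unsplitK (inl i)) (unsplitK (inr i)). Qed.

Definition transpose_mx p : 'M[E]_#|half_index n p| := star_mx 1 transpose_weight p.

Lemma transpose_dot r s t :
  dot (gen r s) (star 1 transpose_weight t) = dot s (star 1 transpose_weight (gen r t)).
Proof.
rewrite (dot_gen _ _ _ transpose_weightP two_neq0) star_gen ?oner_neq0 //.
  rewrite (_ : odd_scale 1 t = t) //; apply/ffunP => I.
  by rewrite !ffunE invr1 if_same scale1r mul1r.
by move=> i; have [-> ->] := transpose_weightP i; rewrite mulVf.
Qed.

Lemma transpose_weight_sign J :
  star_weight 1 transpose_weight J = \prod_(i in J) (-1) ^+ i.
Proof.
rewrite /star_weight expr1n invr1 mul1r; apply: eq_bigr => i _.
by have [-> _] := transpose_weightP i; rewrite mulfK.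
Qed.

Lemma transpose_weight_sqr J :
  star_weight 1 transpose_weight J * star_weight 1 transpose_weight J = 1.
Proof.
rewrite transpose_weight_sign -big_split /= big1 // => i _.
by rewrite -expr2 sqrr_sign.
Qed.

(** [star] is a similitude of the invariant form: both matrices link a set only to its complement,
    so one product of weights gives the multiplier, using that the weights of the form are signs. *)
Lemma star_mx_transpose lam a p :
  (star_mx lam a p)^T *m transpose_mx p *m star_mx lam a p =
  (star_sqr lam a p * star_sqr 1 transpose_weight p)%:A *: transpose_mx p.
Proof.
rewrite -mulmxA; apply/matrixP => x y; rewrite !mxE.
have -> : transpose_mx p *m star_mx lam a p =
    spin_mx p (fun s => star 1 transpose_weight (star lam a s)).
  by rewrite -(spin_mxM (star 1 transpose_weight)) // => s; exact: star_supported.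
set X := enum_val x; set Y := enum_val y.
have pX : odd #|X| = p by exact: half_indexP.
have oC I : odd #|~: I| = odd #|I|.
  by move: n_even; rewrite -{1}(card_ord n) -(cardsC I) oddD; do 2!case: odd.
have [z hz] : exists z : 'I_#|half_index n p|, enum_val z = ~: X.
  by apply: half_enum; rewrite oC.
rewrite (bigD1 z) //= big1 ?addr0; last first.
  move=> k kz; rewrite !mxE star_basis; case: eqP => [eX|]; last by rewrite mulr0 mul0r.
  by case/negP: kz; rewrite -(inj_eq enum_val_inj) hz /X eX setCK.
rewrite !mxE [in LHS]star_basis !star_basis hz setCK eqxx mulr1.
rewrite [star 1 _ _ _]ffunE setCK star_basis -/X -/Y.
have [-> |_] := eqVneq Y (~: X); last by rewrite !mulr0.
rewrite !mulr1 -!algM; congr (_%:A).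
have hc la b : star_sqr la b p = star_weight la b X * star_weight la b (~: X).
  by rewrite star_weight_setC pX.
rewrite !hc; have := transpose_weight_sqr (~: X).
move: (star_weight 1 _ (~: X)) (star_weight 1 _ X) => v u hv.
move: (star_weight lam a X) (star_weight lam a (~: X)) => w w'.
transitivity (w * w' * u * (v * v)); last by ring.
by rewrite hv mulr1; ring.
Qed.

Variables (conj : {lrmorphism E -> E}).

Definition conj_spinor s : exterior E n := [ffun I : {set 'I_n} => conj (s I)].

Lemma spin_mx_conj p U : (forall s, U (conj_spinor s) = conj_spinor (U s)) ->
  map_mx conj (spin_mx p U) = spin_mx p U.
Proof.
move=> hU; apply/matrixP => x y; rewrite !mxE.
have /(congr1 (fun s => s (enum_val x))) := hU (exterior_basis E (enum_val y)).
rewrite [in RHS]ffunE => <-; congr (U _ _); apply/ffunP => I.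
by rewrite !ffunE rmorph_nat.
Qed.

Lemma gen_conj r s : gen r (conj_spinor s) = conj_spinor (gen r s).
Proof.
by case: (split_ordP r) => i ->; rewrite ?gen_lshift ?gen_rshift; apply/ffunP => I;
  rewrite !ffunE ?regular_scaleE; case: (i \in I);
  rewrite ?rmorphM ?rmorph0 ?rmorph_sign ?rmorph_nat ?mulr0.
Qed.

Lemma gen2_mx_conj p r q : map_mx conj (gen2_mx E p r q) = gen2_mx E p r q.
Proof. by apply: spin_mx_conj => s; rewrite !gen_conj. Qed.

Lemma star_mx_conj lam a p : map_mx conj (star_mx lam a p) = star_mx lam a p.
Proof.
apply: spin_mx_conj => s; apply/ffunP => I; rewrite !ffunE rmorphM /= linearZ /= rmorph1.
by [].
Qed.

End StarMatrix.

(** * Reversal in the Clifford algebra as an adjoint *)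

Section Reversal.
Variables (E0 : fieldType) (E : fieldExtType E0) (W : vectType E) (n : nat).
Variables (e : (n + n).-tuple W) (C : falgType E) (iota : {linear W -> C}).
Variable act : C -> {linear exterior E n -> exterior E n}.
Hypotheses (he : basis_of fullv e) (hact : is_spin_module iota e act).
Hypotheses (n_even : ~~ odd n) (two_neq0 : 2%:R != 0 :> E0).
Implicit Types (s t : exterior E n) (r q : 'I_(n + n)) (p : bool).

Let beta := @star E0 E n 1 (@transpose_weight E0 n).

Lemma dot_suml (I : finType) (f : I -> exterior E n) t :
  dot (\sum_i f i) t = \sum_i dot (f i) t.
Proof.
apply: (big_morph (fun s => dot s t)) => [s s'|]; first exact: dotDl.
by rewrite -(scale0r 0) dotZl mul0r.
Qed.

(** Vectors of W are self-adjoint for the form [dot s (beta t)], hence the adjoint of a word is the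
    reversed word. *)
Lemma dot_iota w s t : dot (act (iota w) s) (beta t) = dot s (beta (act (iota w) t)).
Proof.
rewrite (act_iota he hact) dot_suml [in RHS](act_iota he hact) /beta linear_sum /=.
rewrite [RHS]dotC dot_suml; apply: eq_bigr => r _.
by rewrite linearZ /= !dotZl transpose_dot // [in RHS]dotC.
Qed.

Lemma dot_word (l : seq W) s t :
  dot (act (\prod_(w <- l) iota w) s) (beta t) =
  dot s (beta (act (\prod_(w <- rev l) iota w) t)).
Proof.
elim: l t => [|w l IH] t; first by rewrite !big_nil !(sm_one hact).
rewrite rev_cons -cats1 big_cat big_cons big_seq1 !(sm_mul hact) dot_iota.
by rewrite IH.
Qed.

Lemma dot_basis J t : dot (exterior_basis E J) t = t J.
Proof.
rewrite /dot (bigD1 J) //= ffunE eqxx mul1r big1 ?addr0 // => I /negPf IJ.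
by rewrite ffunE IJ mul0r.
Qed.

Lemma dot_half p s t : supported p s ->
  dot s t = \sum_(k < #|half_index n p|) s (enum_val k) * t (enum_val k).
Proof.
rewrite /supported => hs; rewrite -(big_enum_val (fun I => s I * t I)) /dot.
rewrite (bigID (mem (half_index n p))) /= [X in _ + X]big1 ?addr0 // => I.
by rewrite inE => hI; rewrite hs // mul0r.
Qed.

Lemma rho_rev p (l : seq W) : ~~ odd (size l) ->
  transpose_mx E n p *m rho act p (\prod_(w <- rev l) iota w) =
  (rho act p (\prod_(w <- l) iota w))^T *m transpose_mx E n p.
Proof.
move=> hl; rewrite -(spin_mxM (star 1 (@transpose_weight E0 n))); last first.
  move=> s hs; have := @act_word_supported _ _ _ _ e C iota act he hact p (rev l) s hs.
  by rewrite size_rev (negPf hl) addbF.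
apply/matrixP => x y; rewrite mxE -[LHS]dot_basis -/beta -dot_word mxE.
rewrite (@dot_half p); last first.
  have := @act_word_supported _ _ _ _ e C iota act he hact p l _ (supported_basis E (half_indexP x)).
  by rewrite (negPf hl) addbF.
by apply: eq_bigr => k _; rewrite !mxE.
Qed.

Lemma half_spin_rev (A : comAlgType E0) p (s : seq (extend E A * seq W)) : even_expr s ->
  map_mx (in_alg (extend E A)) (transpose_mx E n p) *m
    half_spin act p (clifford_expr iota (rev_expr s) : point C A) =
  (half_spin act p (clifford_expr iota s : point C A))^T *m
    map_mx (in_alg (extend E A)) (transpose_mx E n p).
Proof.
move=> /allP hs; rewrite /clifford_expr /rev_expr big_map !(half_spin_sum hact).
rewrite mulmx_sumr linear_sum mulmx_suml.
apply: eq_big_seq => t /hs ht; rewrite !(half_spin_pure hact) /=.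
rewrite -scalemxAr [in RHS]linearZ /= -scalemxAl -map_mxM rho_rev // map_mxM map_trmx.
by [].
Qed.

End Reversal.

(** * Matrices of G in a good basis *)

Section GoodBasis.
Variables (E0 : fieldType) (E : fieldExtType E0) (conj : {lrmorphism E -> E}).
Variables (W : vectType E) (n : nat) (b psi : W -> W -> E) (e : (n + n).-tuple W).
Variables (a : 'I_(n + n) -> E0) (lam : E0).
Hypothesis he : good_basis conj b psi e a lam.
Implicit Types r q : 'I_(n + n).

Lemma coord_tnth r q : coord e r (tnth e q) = (r == q)%:R.
Proof. by rewrite (tnth_nth 0) coord_free ?(basis_free (gb_basis he)) // eq_sym. Qed.

Lemma good_basis_sym r q : b (tnth e r) (tnth e q) = (q == dual_index r)%:R.
Proof.
rewrite (gb_sym he).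
under eq_bigr => i _ do rewrite !coord_tnth -!natrM !mulnb.
case: (split_ordP r) => i ->; rewrite ?dual_index_lshift ?dual_index_rshift.
  rewrite (bigD1 i) //= big1 ?addr0; last first.
    by move=> j ji; rewrite eq_lshift (negPf ji) eq_rlshift addr0.
  by rewrite eqxx eq_rlshift addr0 eq_sym.
rewrite (bigD1 i) //= big1 ?addr0; last first.
  by move=> j ji; rewrite eq_rshift (negPf ji) eq_lrshift addr0.
by rewrite eqxx eq_lrshift add0r eq_sym.
Qed.

Lemma good_basis_herm r q : psi (tnth e r) (tnth e q) = (a r)%:A *+ (r == q).
Proof.
rewrite (gb_herm he) (bigD1 r) //= big1 ?addr0; last first.
  by move=> i ir; rewrite coord_tnth (negPf ir) mulr0 mul0r.
by rewrite !coord_tnth eqxx mulr1 rmorph_nat mulr_natr.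
Qed.

Lemma good_basis_dual r : a r * a (dual_index r) = lam.
Proof.
case: (split_ordP r) => i ->; rewrite ?dual_index_lshift ?dual_index_rshift.
  exact: (gb_lambda he).
by rewrite mulrC (gb_lambda he).
Qed.

Variable A : comAlgType E0.
Let B := extend E A.

Let G : 'M[B]_(n + n) := gram e B b.

Lemma mulmx_gram (M : 'M[B]_(n + n)) r q : (M *m G) r q = M r (dual_index q).
Proof.
rewrite mxE (bigD1 (dual_index q)) //= big1 ?addr0.
  by rewrite mxE good_basis_sym dual_indexK eqxx scale1r mulr1.
move=> k kq; rewrite mxE good_basis_sym (_ : _ == _ = false) ?scale0r ?mulr0 //.
by apply: contraNF kq => /eqP ->; rewrite dual_indexK.
Qed.

Lemma gram_mulmx (M : 'M[B]_(n + n)) r q : (G *m M) r q = M (dual_index r) q.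
Proof.
rewrite mxE (bigD1 (dual_index r)) //= big1 ?addr0.
  by rewrite mxE good_basis_sym eqxx scale1r mul1r.
by move=> k kq; rewrite mxE good_basis_sym (negPf kq) scale0r mul0r.
Qed.

Lemma gram_sqr : G *m G = 1%:M.
Proof.
by apply/matrixP => i k; rewrite mulmx_gram mxE good_basis_sym mxE (can_eq (@dual_indexK n))
  eq_sym; case: eqP; rewrite ?scale1r ?scale0r.
Qed.

Lemma gram_herm i k : gram e B psi i k = ((a i)%:A : E)%:A *+ (i == k).
Proof.
by rewrite mxE good_basis_herm; case: eqP; rewrite ?mulr1n ?mulr0n ?scale0r.
Qed.

(* [g] commutes with the antilinear [J] defined by psi(z, w) = b(z, J w), *)
(* which maps [e_r] to [a_r e_(r +- n)].                                  *)
Lemma G_points_conj (g : 'M[B]_(n + n)) r j : G_points conj b psi e g ->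
  conj_extend conj (g r j) * ((a j)%:A : E)%:A =
  ((a r)%:A : E)%:A * g (dual_index r) (dual_index j).
Proof.
case=> [[hb _] [hpsi _]]; rewrite -/G in hb.
have GG := gram_sqr.
(* Orthogonality makes G g^T G the inverse of g, since the Gram matrix G of b squares to 1; the
   Hermitian relation then expresses conj g through g^T. *)
have gi : g *m (G *m g^T *m G) = 1%:M by rewrite !mulmxA hb GG.
have ig := mulmx1C gi.
set P := gram e B psi in hpsi.
have PE := gram_herm.
have h1 : P *m (map_mx (@conj_extend E0 E conj A) g)^T = G *m g^T *m G *m P.
  by rewrite -[LHS]mul1mx -ig -!mulmxA; congr (_ *m (_ *m (_ *m _))); rewrite mulmxA.
move/matrixP/(_ j r): h1.
rewrite mxE (bigD1 j) //= big1 ?addr0; last by move=> k kj; rewrite PE eq_sym (negPf kj) mul0r.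
rewrite [RHS]mxE (bigD1 r) //= [X in _ + X]big1 ?addr0; last by move=> k kj; rewrite PE (negPf kj) mulr0.
rewrite !PE !eqxx !mulr1n mulmx_gram gram_mulmx !mxE mulrC => ->.
by rewrite mulrC.
Qed.

End GoodBasis.

(** * The neutral component commutes with [star] *)

Lemma scalar_mx_inj (R : nmodType) d (z z' : R) :
  (0 < d)%N -> z%:M = z'%:M :> 'M_d -> z = z'.
Proof.
by move=> d0 /matrixP/(_ (Ordinal d0) (Ordinal d0)); rewrite !mxE eqxx.
Qed.

Section Preimage.
Variables (E0 : fieldType) (E : fieldExtType E0) (conj : {lrmorphism E -> E}).
Variables (W : vectType E) (n : nat) (b psi : W -> W -> E) (e : (n + n).-tuple W).
Variables (a : 'I_(n + n) -> E0) (lam : E0).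
Variables (C : falgType E) (iota : {linear W -> C}).
Variable act : C -> {linear exterior E n -> exterior E n}.
Hypotheses (hE : imaginary_quadratic E) (hconj : is_conjugation conj).
Hypotheses (he : good_basis conj b psi e a lam) (hact : is_spin_module iota e act).
Hypotheses (n_even : ~~ odd n) (n_gt0 : (0 < n)%N).
Implicit Types (r q : 'I_(n + n)) (p : bool).

Let two_neq0 := imaginary_quadratic_natr hE 1.
Let two_neq0E := imaginary_quadratic_natrE hE 1.

Lemma good_basis_lambda_neq0 : lam != 0.
Proof. by rewrite -(good_basis_dual he (lshift n (Ordinal n_gt0))) mulf_neq0 // (gb_neq0 he). Qed.

Lemma star_sqr_neq0 p : star_sqr lam a p != 0.
Proof.
rewrite mulf_neq0 ?invr_eq0 ?expf_neq0 ?good_basis_lambda_neq0 //.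
by apply/prodf_neq0 => i _; rewrite !mulf_neq0 ?signr_eq0 ?(gb_neq0 he).
Qed.

Lemma star_sqr_transpose_neq0 p : star_sqr 1 (@transpose_weight E0 n) p != 0.
Proof.
rewrite mulf_neq0 ?invr_eq0 ?expf_neq0 ?oner_neq0 //.
apply/prodf_neq0 => i _; have [-> _] := transpose_weightP E0 i.
by rewrite !mulf_neq0 ?signr_eq0 ?invr_eq0.
Qed.

Lemma half_index_gt0 p : (0 < #|half_index n p|)%N.
Proof.
apply/card_gt0P; exists (if p then [set Ordinal n_gt0] else set0).
by rewrite inE; case: p; rewrite ?cards1 ?cards0.
Qed.

Section Points.
Variables (A : comAlgType E0) (p : bool).
Let B := extend E A.
Let toB : 'M[E]_#|half_index n p| -> 'M[B]_#|half_index n p| := map_mx (in_alg B).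
Let conjB : 'M[B]_#|half_index n p| -> 'M[B]_#|half_index n p| :=
  map_mx (@conj_extend E0 E conj A).
Let M := toB (star_mx E lam a p).
Let bt := toB (transpose_mx E n p).
Let G r q := toB (gen2_mx E p r q).
Let alg (k : E0) : B := (k%:A : E)%:A.

Lemma conj_toB N : conjB (toB N) = toB (map_mx conj N).
Proof. by apply/matrixP => i j; rewrite !mxE conj_extend_alg. Qed.

Let MM : M *m M = (alg (star_sqr lam a p))%:M.
Proof. by rewrite /M /toB -map_mxM star_mx_sqr // map_scalar_mx. Qed.

Let conjM : conjB M = M.
Proof. by rewrite /M conj_toB star_mx_conj. Qed.

Let conjG r q : conjB (G r q) = G r q.
Proof. by rewrite /G conj_toB gen2_mx_conj. Qed.

Let conj_bt : conjB bt = bt.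
Proof. by rewrite /bt conj_toB star_mx_conj. Qed.

Let MG r q : M *m G r q = alg (lam^-1 * a r * a q) *: (G (dual_index r) (dual_index q) *m M).
Proof.
rewrite /M /G /toB -!map_mxM star_mx_gen2 ?good_basis_lambda_neq0 //; last exact: gb_lambda he.
by rewrite map_mxZ.
Qed.

Let algM' k l : alg (k * l) = alg k * alg l.
Proof. by rewrite /alg algM; exact: (rmorphM (in_alg B)). Qed.

Let algV k : k != 0 -> alg k^-1 * alg k = 1.
Proof. by move=> hk; rewrite -algM' mulVf // /alg !scale1r. Qed.

Let alg_inj k N N' : k != 0 -> alg k *: N = alg k *: N' -> N = N' :> 'M[B]_#|half_index n p|.
Proof. by move=> hk /(congr1 ( *:%R (alg k^-1))); rewrite !scalerA algV // !scale1r. Qed.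

Let conj_mxM N N' : conjB (N *m N') = conjB N *m conjB N'.
Proof. exact: (map_mxM (@conj_extend E0 E conj A)). Qed.

Let conj_mxZ z N : conjB (z *: N) = conj_extend conj z *: conjB N.
Proof. exact: (map_mxZ (@conj_extend E0 E conj A)). Qed.

Let conj_mxT N : conjB N^T = (conjB N)^T.
Proof. by rewrite /conjB map_trmx. Qed.

(* The spinor norm condition survives in [half_spin] because [transpose_mx] *)
(* turns reversal into transposition.                                       *)
Lemma preimage_half_spin (x : point C A) : G_preimage conj b psi e iota x ->
  [/\ exists2 X', half_spin act p x *m X' = 1%:M & X' *m half_spin act p x = 1%:M,
      (half_spin act p x)^T *m bt *m half_spin act p x = bt
    & exists2 g, G_points conj b psi e g & forall r q,
  half_spin act p x *m G r q =
  (\sum_j \sum_k (g r j * g q k) *: G j k) *m half_spin act p x].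
Proof.
case=> [[[s [hs hx [hxr hrx]]] _] [g hg hG]].
have hr : even_expr (rev_expr s).
  by move: hs; rewrite /even_expr /rev_expr all_map; congr is_true; apply: eq_all => t /=; rewrite size_rev.
have XX' := half_spinM (gb_basis he) hact p x hr; rewrite hxr in XX'.
have X'X := half_spinM (gb_basis he) hact p (clifford_expr iota (rev_expr s) : point C A) hs.
rewrite -hx hrx in X'X.
rewrite !(half_spin1 hact) in XX' X'X.
split.
- by exists (half_spin act p (clifford_expr iota (rev_expr s) : point C A)).
- have := half_spin_rev (gb_basis he) hact two_neq0 p hs; rewrite -/toB -/bt -hx => <-.
  by rewrite -mulmxA -X'X mulmx1.
- exists g => // r q; exact: (half_spin_covers (gb_basis he) hact p hs hx hg).
Qed.

Lemma preimage_star (x : point C A) : G_preimage conj b psi e iota x ->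
  exists2 eps : A, eps * eps = 1 &
    M *m conjB (half_spin act p x) = inr_extend E eps *: (half_spin act p x *m M).
Proof.
move=> /preimage_half_spin; set X := half_spin act p x.
move=> [[X' XX' X'X] Xbt [g hG Xg]].
pose c := star_sqr lam a p; have MMc : M *m M = (alg c)%:M := MM.
have c0 : c != 0 := star_sqr_neq0 p.
have l0 := good_basis_lambda_neq0.
pose S r q := \sum_j \sum_k (g r j * g q k) *: G j k.
(* Since M^2 = c, this is c times the conjugate of X transported by M. *)
pose Y := M *m conjB X *m M.
have hJ := G_points_conj he _ _ hG.
(* Compatibility of g with J, in the form [hJ], moves the conjugated entries of g to the dual
   indices. *)
have MS r q : M *m conjB (S r q) =
    alg (lam^-1 * a r * a q) *: (S (dual_index r) (dual_index q) *m M).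
  rewrite /conjB /S (raddf_sum (map_mx (@conj_extend E0 E conj A))) mulmx_sumr.
  rewrite [in RHS](reindex_inj (inv_inj (@dual_indexK n))) mulmx_suml scaler_sumr.
  apply: eq_bigr => j _; rewrite /= (raddf_sum (map_mx (@conj_extend E0 E conj A))) mulmx_sumr.
  rewrite [in RHS](reindex_inj (inv_inj (@dual_indexK n))) mulmx_suml scaler_sumr.
  apply: eq_bigr => k _ /=; rewrite -/(conjB _) conj_mxZ conjG -scalemxAr MG -scalemxAl !scalerA.
  congr (_ *: _); rewrite rmorphM !algM'.
  transitivity (alg lam^-1 * (conj_extend conj (g r j) * alg (a j))
                * (conj_extend conj (g q k) * alg (a k))); first by ring.
  by rewrite !hJ -/(alg _) -/(alg _); ring.
have cXG r q : conjB X *m G r q = conjB (S r q) *m conjB X.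
  by rewrite -[G r q]conjG -!conj_mxM Xg.
have YG r q : Y *m G r q = S r q *m Y.
  rewrite /Y -mulmxA MG -scalemxAr !mulmxA -(mulmxA M) cXG mulmxA MS !dual_indexK.
  rewrite -!scalemxAl scalerA -algM'.
  set r' := dual_index r; set q' := dual_index q.
  have -> : lam^-1 * a r * a q * (lam^-1 * a r' * a q') = 1.
    transitivity (lam^-1 * (a r * a r') * (lam^-1 * (a q * a q'))); first by ring.
    by rewrite !(good_basis_dual he) mulVf // mulr1.
  by rewrite /alg !scale1r ?mulmxA.
(* X and Y transform products of two generators in the same way, so X^-1 Y commutes with all of
   them. *)
have [z hz] : exists z, X' *m Y = z%:M.
  apply: (@commutant_scalar _ _ n p two_neq0E _ (in_alg B)) => // r q.
  have -> : spin_mx p (gen_comm r q) = gen2_mx E p r q - gen2_mx E p q r.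
    by apply/matrixP => i j; rewrite !mxE ffunE [in X in _ + X]ffunE.
  have hc u v : G u v *m (X' *m Y) = X' *m Y *m G u v.
    by rewrite -[X' *m Y *m _]mulmxA YG -[S u v]mulmx1 -XX' !mulmxA -(mulmxA X') -Xg !mulmxA X'X mul1mx.
  rewrite (map_mxB (in_alg B)) mulmxBl mulmxBr -/(G r q) -/(G q r) !hc.
  by [].
have hY : Y = z *: X by rewrite -[Y]mul1mx -XX' -mulmxA hz mul_mx_scalar.
pose eps := z * alg c^-1.
have E1 : M *m conjB X = eps *: (X *m M).
  apply: (@alg_inj c) => //; rewrite -mul_mx_scalar -MMc mulmxA -/Y hY -scalemxAl.
  by rewrite scalerA /eps mulrCA [alg c * _]mulrC algV // mulr1.
(* X and its conjugate preserve the form [bt], while M multiplies it by c d. Evaluating the form on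
   both sides of [E1] leaves only eps^2. *)
have E2 : eps * eps = 1.
  set d := star_sqr 1 (@transpose_weight E0 n) p.
  have cd0 : c * d != 0 by rewrite mulf_neq0 // star_sqr_transpose_neq0.
  have MbM : M^T *m bt *m M = alg (c * d) *: bt.
    rewrite /M /bt /toB map_trmx -!map_mxM star_mx_transpose // map_mxZ.
    by [].
  have bb : bt *m bt = (alg d)%:M.
    by rewrite /bt /toB -map_mxM star_mx_sqr // map_scalar_mx.
  have d0 : d != 0 := star_sqr_transpose_neq0 p.
  have hT N N' : (N *m N')^T *m bt *m (N *m N') = N'^T *m (N^T *m bt *m N) *m N'.
    by rewrite trmx_mul !mulmxA.
  have trZ k N : (k *: N)^T = k *: N^T :> 'M[B]_#|half_index n p| by rewrite linearZ.
  have h1 : (M *m conjB X)^T *m bt *m (M *m conjB X) = alg (c * d) *: bt.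
    rewrite hT MbM.
    rewrite -scalemxAr -scalemxAl -conj_mxT -{1}conj_bt -!conj_mxM Xbt.
    by rewrite conj_bt.
  have h2 : (eps * eps) *: bt = bt.
    apply: (@alg_inj (c * d)) => //; rewrite -[in RHS]h1 E1 trZ.
    by rewrite -!scalemxAl -!scalemxAr hT Xbt MbM !scalerA mulrC.
  apply: (scalar_mx_inj (half_index_gt0 p)); apply: (@alg_inj d) => //.
  by rewrite -!mul_scalar_mx -bb mulmx1 -mulmxA mul_mx_scalar h2.
(* The conjugate of [E1] is substituted into [E1]; then M^2 = c cancels. *)
have E3 : eps * conj_extend conj eps = 1.
  have E1c : M *m X = conj_extend conj eps *: (conjB X *m M).
    rewrite -[LHS](_ : conjB (M *m conjB X) = _); last first.
      rewrite conj_mxM conjM; congr (_ *m _); apply/matrixP => i j.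
      by rewrite !mxE conj_extendK.
    by rewrite E1 conj_mxZ conj_mxM conjM.
  have cX : conjB X *m conjB X' = 1%:M.
    by rewrite -conj_mxM XX' /conjB map_mx1.
  have h1 : conjB X = (eps * conj_extend conj eps) *: conjB X.
    apply: (@alg_inj c) => //; rewrite -mul_scalar_mx -MMc -mulmxA E1 -scalemxAr mulmxA E1c.
    by rewrite -scalemxAl -mulmxA MMc mul_mx_scalar !scalerA mulrC.
  by apply: (scalar_mx_inj (half_index_gt0 p)); rewrite -cX h1 -scalemxAl cX scale_scalar_mx mulr1.
(* Both are inverse to eps, so eps is fixed by conjugation and comes from A. *)
have E4 : conj_extend conj eps = eps.
  by rewrite -[LHS]mul1r -E2 -mulrA E3 mulr1.
have E5 := conj_extend_fixed hE hconj E4.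
exists (inr_section eps); last by rewrite -E5.
by apply: (can_inj (@inr_extendK E0 E A)); rewrite rmorphM rmorph1 /= -E5 E2.
Qed.

End Points.
End Preimage.

(** * Descent when the square of [star] is a norm *)

Lemma extend_map_conj (F : fieldType) (K : fieldExtType F) (conj : {lrmorphism K -> K})
    (A A' : comAlgType F) (h : {lrmorphism A -> A'}) (z : extend K A) :
  extend_map h (conj_extend conj z) = conj_extend conj (extend_map h z).
Proof.
elim/tens_ind: z => [|x y hx hy|a c]; first by rewrite !raddf0.
  by rewrite !raddfD /= hx hy.
by rewrite conj_extend_pure /extend_map !tens_map_pure conj_extend_pure.
Qed.

Lemma extend_map_alg (F : fieldType) (K : fieldExtType F)
    (A A' : comAlgType F) (h : {lrmorphism A -> A'}) (z : K) :
  extend_map h (z%:A : extend K A) = z%:A.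
Proof. by rewrite linearZ rmorph1. Qed.

Lemma extend_map_inr (F : fieldType) (K : fieldExtType F)
    (A A' : comAlgType F) (h : {lrmorphism A -> A'}) (c : A) :
  extend_map h (inr_extend K c) = inr_extend K (h c).
Proof. exact: tens_map_pure. Qed.

(** There are more natural numbers than roots. The nonroot is sought among them because they are
    fixed by conjugation. *)
Lemma poly_nat_nonroot (F : fieldType) (q : {poly F}) :
  (forall k, k.+1%:R != 0 :> F) -> q != 0 -> exists k : nat, q.[k%:R] != 0.
Proof.
move=> hF q0; apply: contrapT => hq.
have natr_inj : injective (fun k : nat => k%:R : F).
  move=> i j; wlog lij : i j / (i <= j)%N.
    by move=> H; case: (leqP i j) => [/H//|/ltnW/H H1 /esym/H1].
  move/eqP; rewrite eq_sym -subr_eq0 -natrB //; case E: (j - i)%N => [|k].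
    by move=> _; apply/eqP; rewrite eqn_leq lij -subn_eq0 E.
  by rewrite (negPf (hF k)).
have := @max_poly_roots F q [seq (k%:R : F) | k <- iota 0 (size q)] q0.
rewrite size_map size_iota ltnn map_inj_uniq // iota_uniq => H.
suff : false by []. apply: H => //.
apply/allP => _ /mapP[k _ ->]; apply/rootP/eqP/negPn/negP => hk.
by apply: hq; exists k.
Qed.

Lemma conjugate_mxM (R : pzSemiRingType) d (P Q X Y : 'M[R]_d) : Q *m P = 1%:M ->
  P *m (X *m Y) *m Q = P *m X *m Q *m (P *m Y *m Q).
Proof. by move=> QP; rewrite !mulmxA -(mulmxA _ Q) QP mulmx1. Qed.

(** * Hilbert 90 for invertible matrices *)

Section HilbertNinety.
Variables (E0 : fieldType) (E : fieldExtType E0) (conj : {lrmorphism E -> E}).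
Hypotheses (hE : imaginary_quadratic E) (hconj : is_conjugation conj).

(* With [z = t + theta], invertibility of [z + conj z *: N] is the nonvanishing *)
(* at [t] of a polynomial whose value at [theta] is [det (2 theta)].            *)
Lemma hilbert90_mx d (N : 'M[E]_d) : N *m map_mx conj N = 1%:M ->
  exists2 Q : 'M[E]_d, Q \in unitmx & N *m map_mx conj Q = Q.
Proof.
move=> hN; have [theta th0 cth] := imaginary_element hE hconj.
pose Qx : 'M[{poly E}]_d := 'X *: map_mx polyC (1%:M + N) + map_mx polyC (theta *: (1%:M - N)).
have hQx (k : E) : (\det Qx).[k] = \det (k *: (1%:M + N) + theta *: (1%:M - N)).
  rewrite -horner_evalE -det_map_mx; congr (\det _); apply/matrixP => i j.
  by rewrite !mxE /= /horner_eval !hornerE.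
have [k hk] : exists k : nat, (\det Qx).[k%:R] != 0.
  apply: poly_nat_nonroot; first exact: imaginary_quadratic_natrE.
  apply/eqP => q0; have := hQx theta; rewrite q0 horner0.
  have -> : theta *: (1%:M + N) + theta *: (1%:M - N) = (2%:R * theta)%:M.
    by apply/matrixP => i j; rewrite !mxE; case: (i == j); rewrite ?mulr1n ?mulr0n; ring.
  rewrite det_scalar => /esym/eqP; rewrite expf_eq0 mulf_eq0 (negPf th0).
  by rewrite (negPf (imaginary_quadratic_natrE hE 1)) andbF.
pose z := k%:R + theta.
exists (z%:M + conj z *: N).
  rewrite unitmxE unitfE; rewrite hQx in hk; apply: contra hk => /eqP <-; apply/eqP.
  congr (\det _); apply/matrixP => i j; rewrite !mxE /z rmorphD /= rmorph_nat cth.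
  by case: (i == j); rewrite ?mulr1n ?mulr0n; ring.
rewrite raddfD /= map_scalar_mx map_mxZ /= (conjK hE hconj) mulmxDr -scalemxAr hN.
by rewrite mul_mx_scalar scalemx1 addrC.
Qed.

End HilbertNinety.

Section Descent.
Variables (E0 : fieldType) (E : fieldExtType E0) (conj : {lrmorphism E -> E}).
Variables (W : vectType E) (n : nat) (b psi : W -> W -> E) (e : (n + n).-tuple W).
Variables (a : 'I_(n + n) -> E0) (lam : E0).
Variables (C : falgType E) (iota : {linear W -> C}).
Variable act : C -> {linear exterior E n -> exterior E n}.
Hypotheses (hE : imaginary_quadratic E) (hconj : is_conjugation conj).
Hypotheses (he : good_basis conj b psi e a lam) (hact : is_spin_module iota e act).
Hypotheses (n_even : ~~ odd n) (n_gt0 : (0 < n)%N).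
Variable p : bool.

Let toB (A : comAlgType E0) (N : 'M[E]_#|half_index n p|) :=
  map_mx (in_alg (extend E A)) N.

Let star_sign (A : comAlgType E0) (x : point C A) (eps : A) : Prop :=
  toB A (star_mx E lam a p) *m map_mx (@conj_extend E0 E conj A) (half_spin act p x) =
  inr_extend E eps *: (half_spin act p x *m toB A (star_mx E lam a p)).

Let star_unit : star_mx E lam a p \in unitmx.
Proof.
have c0 : ((star_sqr lam a p)%:A : E) != 0.
  by rewrite -in_algE fmorph_eq0 (star_sqr_neq0 hE he n_gt0).
have := @star_mx_sqr E0 E n n_even lam a p => /(congr1 ( *:%R (star_sqr lam a p)%:A^-1)).
rewrite scalemxAl scale_scalar_mx mulVf // => /mulmx1_unit[_ hu].
by [].
Qed.

Let toB_inv A N : N \in unitmx -> toB A N *m toB A (invmx N) = 1%:M.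
Proof. by move=> hN; rewrite /toB -map_mxM mulmxV // map_mx1. Qed.
Let toB_invl A N : N \in unitmx -> toB A (invmx N) *m toB A N = 1%:M.
Proof. by move=> hN; rewrite /toB -map_mxM mulVmx // map_mx1. Qed.

Lemma star_sign_uniq (A : comAlgType E0) (x : point C A) X' eps eps' :
  X' *m half_spin act p x = 1%:M -> star_sign x eps -> star_sign x eps' -> eps = eps'.
Proof.
move=> hX h1 h2; apply: (can_inj (@inr_extendK E0 E A)).
apply: (scalar_mx_inj (half_index_gt0 n_gt0 p)).
have h3 : inr_extend E eps *: (half_spin act p x *m toB A (star_mx E lam a p)) =
   inr_extend E eps' *: (half_spin act p x *m toB A (star_mx E lam a p)).
  by rewrite -h1 -h2.
have hk z : X' *m (z *: (half_spin act p x *m toB A (star_mx E lam a p)))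
    *m toB A (invmx (star_mx E lam a p)) = z%:M.
  by rewrite -scalemxAr -scalemxAl mulmxA hX mul1mx toB_inv // scalemx1.
by rewrite -hk h3 hk.
Qed.

Lemma star_sign_map (A A' : comAlgType E0) (h : {lrmorphism A -> A'}) (x : point C A) eps :
  star_sign x eps -> star_sign (point_map h x) (h eps).
Proof.
rewrite /star_sign => /(congr1 (map_mx (extend_map h))).
have hB N : map_mx (extend_map h) (toB A N) = toB A' N.
  by apply/matrixP => i j; rewrite !mxE extend_map_alg.
rewrite map_mxZ !map_mxM !hB (half_spin_map hact) /= extend_map_inr => <-.
by congr (_ *m _); apply/matrixP => i j; rewrite !mxE extend_map_conj.
Qed.

Let halfE (A : comAlgType E0) (z : A) := (2%:R : E0)^-1 *: (1 + z).

(** A regular function is typed as a total function on [point C A], so the value 0 is used where no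
    sign exists. On the preimage a sign exists and is unique, so the choice of [cid] is
    immaterial. *)
Let sign_function (A : comAlgType E0) (x : point C A) : A :=
  match pselect (exists eps, star_sign x eps) with
  | left h => halfE (sval (cid h))
  | right _ => 0
  end.

Let sign_functionE (A : comAlgType E0) (x : point C A) X' eps :
  X' *m half_spin act p x = 1%:M -> star_sign x eps -> sign_function x = halfE eps.
Proof.
move=> hX hs; rewrite /sign_function; case: pselect => [h|]; last by case; exists eps.
by case: cid => eps' /= hs'; rewrite (star_sign_uniq hX hs hs').
Qed.

Lemma G1_star (A : comAlgType E0) (x : point C A) : G1 conj b psi e iota x ->
  toB A (star_mx E lam a p) *m map_mx (@conj_extend E0 E conj A) (half_spin act p x) =
  half_spin act p x *m toB A (star_mx E lam a p).
Proof.
case=> hx hf.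
have two0 := imaginary_quadratic_natr hE 1.
have [[X' _ X'X] _ _] := preimage_half_spin hE he hact p hx.
have [eps _ hs] := preimage_star hE hconj he hact n_even n_gt0 p hx.
have := hf (@sign_function) _ _ _.
rewrite (sign_functionE X'X hs) => h1.
suff e1 : eps = 1 by move: hs; rewrite e1 rmorph1 scale1r.
have : halfE eps = 1.
  apply: h1.
  - move=> A1 A2 h y hy.
    have [[Y' _ Y'Y] _ _] := preimage_half_spin hE he hact p hy.
    have [eta _ ht] := preimage_star hE hconj he hact n_even n_gt0 p hy.
    rewrite (sign_functionE Y'Y ht) (@sign_functionE _ _ (map_mx (extend_map h) Y') (h eta)).
    + by rewrite /halfE linearZ; congr (_ *: _); rewrite raddfD /= rmorph1.
    + by rewrite (half_spin_map hact) -map_mxM Y'Y map_mx1.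
    + exact: star_sign_map.
  - move=> A1 y hy.
    have [[Y' _ Y'Y] _ _] := preimage_half_spin hE he hact p hy.
    have [eta et ht] := preimage_star hE hconj he hact n_even n_gt0 p hy.
    rewrite (sign_functionE Y'Y ht) /halfE -scalerAl -scalerAr scalerA mulrDl !mulrDr.
    rewrite et !mul1r mulr1 [eta + 1]addrC -mulr2n -scaler_nat scalerA -mulrA mulVf //.
    by rewrite mulr1.
  - move=> A1; rewrite (@sign_functionE _ _ 1%:M 1) /halfE.
    + by rewrite -mulr2n -scaler_nat scalerA mulVf // scale1r.
    + by rewrite (half_spin1 hact) mulmx1.
    + rewrite /star_sign (half_spin1 hact) !rmorph1 scale1r mul1mx.
      exact: mulmx1.
rewrite /halfE => /(congr1 (fun z => (2%:R : E0) *: z)); rewrite scalerA mulfV // scale1r.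
by rewrite scaler_nat mulr2n => /addrI.
Qed.

Lemma star_sqr_norm_defined : is_norm conj (star_sqr lam a p) ->
  defined_over_E0 conj b psi e iota act p.
Proof.
case=> u u0 hu.
(* Dividing by u, of norm c_p, turns [star] into a cocycle for the group of order 2. *)
pose N := u^-1 *: star_mx E lam a p.
have hN : N *m map_mx conj N = 1%:M.
  rewrite /N map_mxZ star_mx_conj -scalemxAl -scalemxAr star_mx_sqr // !scale_scalar_mx.
  by rewrite hu fmorphV mulrA -invfM mulVf // mulf_neq0 // fmorph_eq0.
have [Q uQ hQ] := hilbert90_mx hE hconj hN.
have NP : map_mx conj (invmx Q) = invmx Q *m N.
  rewrite -[LHS]mul1mx -(mulVmx uQ) -{2}hQ -!mulmxA -map_mxM mulmxV //.
  by rewrite map_mx1 mulmx1.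
(* Since Q trivialises the cocycle, commutation with [star] becomes invariance under plain
   conjugation. The entries then come from A and [inr_section] recovers them; this is ensured at
   points of G_1 only. *)
pose Xh (A : comAlgType E0) (x : point C A) := toB A (invmx Q) *m half_spin act p x *m toB A Q.
pose rhoA (A : comAlgType E0) (x : point C A) := map_mx (@inr_section E0 E A) (Xh A x).
have Xfix A (x : point C A) : G1 conj b psi e iota x -> Xh A x = map_mx (@inr_extend E0 E A) (rhoA A x).
  move=> hx; apply/matrixP => i j; rewrite [RHS]mxE [in RHS]mxE.
  apply: (conj_extend_fixed hE hconj).
  have conj_toB L : map_mx (@conj_extend E0 E conj A) (toB A L) = toB A (map_mx conj L).
    by apply/matrixP => k l; rewrite !mxE conj_extend_alg.
  have NX : toB A N *m map_mx (@conj_extend E0 E conj A) (half_spin act p x) =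
      half_spin act p x *m toB A N.
    by rewrite /N /toB map_mxZ -scalemxAl G1_star // -scalemxAr.
  have : map_mx (@conj_extend E0 E conj A) (Xh A x) = Xh A x.
    rewrite /Xh !map_mxM !conj_toB NP {1}/toB map_mxM -/(toB _ _) -/(toB _ _).
    rewrite -!mulmxA (mulmxA (toB A N)).
    rewrite NX -!mulmxA.
    by rewrite -map_mxM hQ.
  by move/matrixP/(_ i j); rewrite mxE.
exists rhoA, (invmx Q); split; last first.
- move=> A x hx; rewrite -/(toB _ _).
  have -> : map_mx (fun c : A => pure 1 c : extend E A) (rhoA A x) = Xh A x by rewrite Xfix.
  by rewrite /Xh -!mulmxA toB_inv // mulmx1.
- by rewrite unitmx_inv.
split.
- move=> A A' h x _.
  have -> : rhoA A' (point_map h x) =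
      map_mx (@inr_section E0 E A') (map_mx (extend_map h) (Xh A x)).
    have hB L : map_mx (extend_map h) (toB A L) = toB A' L.
      by apply/matrixP => k l; rewrite !mxE extend_map_alg.
    by rewrite /rhoA /Xh (half_spin_map hact) !map_mxM !hB.
  apply/matrixP => i j; rewrite [LHS]mxE [X in inr_section X]mxE inr_section_map.
  by rewrite [RHS]mxE; congr (h _); rewrite [RHS]mxE.
- move=> A; rewrite /rhoA /Xh (half_spin1 hact) mulmx1 toB_invl //.
  rewrite -(map_mx1 (@inr_extend E0 E A)).
  by apply/matrixP => i j; rewrite mxE mxE inr_extendK.
- move=> A x y hx hy.
  have XhM : Xh A (x * y) = Xh A x *m Xh A y.
    case: (hy) => -[[[s [hs ys _]] _] _] _.
    have := half_spinM (gb_basis he) hact p x hs; rewrite -ys /Xh => ->.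
    exact: conjugate_mxM (toB_inv A uQ).
  have -> : rhoA A (x * y) =
      map_mx (@inr_section E0 E A) (map_mx (@inr_extend E0 E A) (rhoA A x *m rhoA A y)).
    rewrite (map_mxM (@inr_extend E0 E A) (rhoA A x) (rhoA A y)); congr map_mx.
    exact: etrans XhM (congr2 mulmx (Xfix A x hx) (Xfix A y hy)).
  by apply/matrixP => i j; rewrite [LHS]mxE [in LHS]mxE inr_extendK.
Qed.

End Descent.

(** * Dual numbers and infinitesimal points of G_1 *)

(* The algebra of dual numbers over a field: the pair [(x, y)] is [x + y eps]. *)
Definition dual_number (F : fieldType) : Type := (F^o * F^o)%type.

Section DualNumber.
Variable F : fieldType.
Notation dual := (dual_number F).
HB.instance Definition _ := GRing.Lmodule.on dual.

Definition dual_one : dual := (1, 0).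
Definition dual_mul (x y : dual) : dual := (x.1 * y.1, x.1 * y.2 + x.2 * y.1).

Fact dual_mulA : associative dual_mul.
Proof. by move=> x y z; congr (_, _) => /=; ring. Qed.
Fact dual_mulC : commutative dual_mul.
Proof. by move=> x y; congr (_, _) => /=; ring. Qed.
Fact dual_mul1 : left_id dual_one dual_mul.
Proof. by case=> x y; congr (_, _) => /=; ring. Qed.
Fact dual_mulD : left_distributive dual_mul +%R.
Proof. by move=> x y z; congr (_, _) => /=; ring. Qed.
Fact dual_one_neq0 : dual_one != 0.
Proof. by apply/negP => /eqP[] /eqP; rewrite oner_eq0. Qed.
HB.instance Definition _ := GRing.Zmodule_isComNzRing.Build dual
  dual_mulA dual_mulC dual_mul1 dual_mulD dual_one_neq0.

Fact dual_scaleAl (k : F) (x y : dual) : k *: (x * y) = (k *: x : dual) * y.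
Proof.
suff h : (k * (x.1 * y.1), k * (x.1 * y.2 + x.2 * y.1)) =
    (k * x.1 * y.1, k * x.1 * y.2 + k * x.2 * y.1) :> dual by exact: h.
by congr (_, _); ring.
Qed.
HB.instance Definition _ := GRing.Lmodule_isLalgebra.Build F dual dual_scaleAl.
HB.instance Definition _ := GRing.Lalgebra_isComAlgebra.Build F dual.

Definition dual_eps : dual := (0, 1).

Lemma dual_eps_sqr : dual_eps * dual_eps = 0.
Proof. by congr (_, _) => /=; ring. Qed.

Definition dual_aug (x : dual) : dual := (x.1, 0).

Fact dual_aug_nmod : nmod_morphism dual_aug.
Proof. by split=> // x y; congr (_, _) => /=; rewrite addr0. Qed.
HB.instance Definition _ := GRing.isNmodMorphism.Build dual dual dual_aug dual_aug_nmod.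
Fact dual_aug_monoid : monoid_morphism dual_aug.
Proof. by split=> // x y; congr (_, _) => /=; ring. Qed.
HB.instance Definition _ := GRing.isMonoidMorphism.Build dual dual dual_aug dual_aug_monoid.
Fact dual_aug_scale : scalable dual_aug.
Proof. by move=> k x; congr (_, _); rewrite /= regular_scaleE mulr0. Qed.
HB.instance Definition _ := GRing.isScalable.Build F dual dual *:%R dual_aug dual_aug_scale.

Definition dual_augmentation : {lrmorphism dual -> dual} := dual_aug.

Lemma dual_aug_eps : dual_augmentation dual_eps = 0.
Proof. by []. Qed.

Lemma dual_idempotent (x : dual) : (2%:R : F) != 0 -> x * x = x -> dual_augmentation x = 1 -> x = 1.
Proof.
case: x => x y h2 [_ /= hy] [hx]; rewrite hx in hy *; congr (_, _).
by move: hy; rewrite mul1r mulr1 => /(canRL (addrK _)); rewrite subrr.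
Qed.

End DualNumber.

(** As a polynomial in t, det(1 + t N) is 1 at t = 0, so the factor theorem splits off t from the
    difference. *)
Lemma det_1addZ (R : comNzRingType) d (eta : R) (N : 'M[R]_d) :
  exists k, \det (1%:M + eta *: N) = 1 + eta * k.
Proof.
pose Q : 'M[{poly R}]_d := map_mx polyC 1%:M + 'X *: map_mx polyC N.
have hQ (t : R) : (\det Q).[t] = \det (1%:M + t *: N).
  rewrite -horner_evalE -det_map_mx; congr (\det _); apply/matrixP => i j.
  by rewrite !mxE /= /horner_eval !hornerE.
have : root (\det Q - 1) 0.
  by rewrite rootE hornerD hQ hornerN hornerC scale0r addr0 det1 subrr.
move/factor_theorem => [q hq]; exists q.[eta].
rewrite -hQ -[\det Q](subrK 1) hq hornerD hornerM hornerXsubC hornerC subr0.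
by rewrite addrC mulrC.
Qed.

(** Entry (i, j) of the skew-Hermitian condition in [N_herm]: v is conj u, k is lambda^-1 a_r a_q,
    and ir, jq, ... are Kronecker deltas, of which only the rule (i == r) a_i = (i == r) a_r is
    kept. *)
Lemma herm_identity (R : comPzRingType) (u v k ai aj ar aq ar' aq' : R)
    (ir iq ir' iq' jr jq jr' jq' : R) :
  k * aq' = ar -> k * ar' = aq ->
  ir * ai = ir * ar -> iq * ai = iq * aq -> ir' * ai = ir' * ar' -> iq' * ai = iq' * aq' ->
  jr * aj = jr * ar -> jq * aj = jq * aq -> jr' * aj = jr' * ar' -> jq' * aj = jq' * aq' ->
  (u * (4%:R * (iq' * jr) - 4%:R * (ir' * jq))
     + v * k * (4%:R * (iq * jr') - 4%:R * (ir * jq'))) * aj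
  + ai * (v * (4%:R * (jq' * ir) - 4%:R * (jr' * iq))
          + u * k * (4%:R * (jq * ir') - 4%:R * (jr * iq'))) = 0.
Proof.
move=> k1 k2 h1 h2 h3 h4 h5 h6 h7 h8.
transitivity (4%:R * (u * (iq' * (jr * aj) - ir' * (jq * aj))
     + v * k * (iq * (jr' * aj) - ir * (jq' * aj))
  + (v * (jq' * (ir * ai) - jr' * (iq * ai))
          + u * k * (jq * (ir' * ai) - jr * (iq' * ai))))); first by ring.
rewrite h1 h2 h3 h4 h5 h6 h7 h8 -k1 -k2; by ring.
Qed.

(** To first order, conjugation by 1 + y t adds the bracket [y, c] t. *)
Lemma pure_bracket (F : fieldType) (K : falgType F) (B : comAlgType F) (c y : K) (t : B) :
  t * t = 0 ->
  (1 + pure y t) * pure c 1 = (pure c 1 + pure (y * c - c * y) t) * (1 + pure y t).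
Proof.
move=> h2; rewrite mulrDl mul1r mulrDr mulr1 mulrDl !pureM h2 pure0r addr0 mulr1 mul1r.
by rewrite -addrA -pureDl subrK.
Qed.

Lemma pureNl (F : fieldType) (K : falgType F) (B : comAlgType F) (c : K) (t : B) :
  pure (- c) t = - pure c t.
Proof. by apply: (addrI (pure c t)); rewrite -pureDl !subrr pure0l. Qed.

Lemma pureNr (F : fieldType) (K : falgType F) (B : comAlgType F) (c : K) (t : B) :
  pure c (- t) = - pure c t.
Proof. by apply: (addrI (pure c t)); rewrite -pureDr !subrr pure0r. Qed.

Lemma pure_commutators (F : fieldType) (K : falgType F) (B : comAlgType F)
    (X Y X' Y' : K) (u u' : F) (t : B) :
  pure (u *: (X - Y) + u' *: (X' - Y')) t =
  pure X (u *: t) + (pure Y (- (u *: t)) + (pure X' (u' *: t) + pure Y' (- (u' *: t)))).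
Proof. by rewrite pureDl !pureZ !pureDl !pureNl !pureNr !addrA. Qed.

Lemma conjugate_infinitesimal (F : fieldType) (B : comAlgType F) d (P V : 'M[F]_d)
    (S : 'M[B]_d) (t : B) : P \in unitmx ->
  map_mx (in_alg B) P *m (1%:M + t *: map_mx (in_alg B) V) = S *m map_mx (in_alg B) P ->
  S = 1%:M + t *: map_mx (in_alg B) (P *m V *m invmx P).
Proof.
move=> uP h; have PP : map_mx (in_alg B) P *m map_mx (in_alg B) (invmx P) = 1%:M.
  by rewrite -map_mxM mulmxV // map_mx1.
rewrite -[S]mulmx1 -PP mulmxA -h mulmxDr mulmx1 mulmxDl PP -scalemxAr -scalemxAl.
by rewrite !map_mxM.
Qed.

Lemma infinitesimal_form (R : comNzRingType) d (eta : R) (N N' G : 'M[R]_d) :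
  eta * eta = 0 -> N *m G + G *m N' = 0 ->
  (1%:M + eta *: N) *m G *m (1%:M + eta *: N') = G.
Proof.
move=> h2 hN; rewrite mulmxDl mul1mx mulmxDr mulmx1 mulmxDl -!scalemxAl -!scalemxAr.
by rewrite !scalerA h2 scale0r addr0 -addrA -scalerDr hN scaler0 addr0.
Qed.

(** * Points 1 + eps y with y in the Lie algebra of G *)

Section Infinitesimal.
Variables (E0 : fieldType) (E : fieldExtType E0) (conj : {lrmorphism E -> E}).
Variables (W : vectType E) (n : nat) (b psi : W -> W -> E) (e : (n + n).-tuple W).
Variables (a : 'I_(n + n) -> E0) (lam : E0).
Variables (C : falgType E) (iota : {linear W -> C}).
Variable act : C -> {linear exterior E n -> exterior E n}.
Hypotheses (hE : imaginary_quadratic E) (hconj : is_conjugation conj).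
Hypotheses (he : good_basis conj b psi e a lam) (hact : is_spin_module iota e act).
Hypotheses (hC : clifford_map b iota).
Hypotheses (n_even : ~~ odd n) (n_gt0 : (0 < n)%N).
Implicit Types (i j r q : 'I_(n + n)).

Let c_ r : C := iota (tnth e r).

Lemma good_basis_symD z z' w w' : b (z + z') (w + w') = b z w + b z w' + (b z' w + b z' w').
Proof.
rewrite !(gb_sym he) -!big_split; apply: eq_bigr => i _ /=.
by rewrite !linearD /=; ring.
Qed.

Lemma clifford_gen r q :
  c_ r * c_ q + c_ q * c_ r = (2%:R * (q == dual_index r)%:R : E)%:A.
Proof.
have := hC (tnth e r + tnth e q); rewrite linearD /= mulrDl !mulrDr !hC.
rewrite good_basis_symD !(good_basis_sym he) => /eqP.
rewrite !scalerDl -!addrA (inj_eq (addrI _)) !addrA (inj_eq (addIr _)) => /eqP ->.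
rewrite -scalerDl; congr (_ *: _).
have -> : (r == dual_index q) = (q == dual_index r).
  by rewrite -{1}[r]dual_indexK (can_eq (@dual_indexK n)) eq_sym.
by ring.
Qed.

Definition bivector r q : C := c_ r * c_ q - c_ q * c_ r.

(** The matrix of bracketing with [bivector r q] on W; in 4 = 2 * 2, one factor comes from the
    Clifford relation, the other from antisymmetrising. *)
Definition bivector_mx r q : 'M[E]_(n + n) :=
  \matrix_(i, j) (4%:R * ((i == dual_index q) && (j == r))%:R
                  - 4%:R * ((i == dual_index r) && (j == q))%:R).

Lemma bivector_bracket r q i :
  bivector r q * c_ i - c_ i * bivector r q = \sum_j bivector_mx r q i j *: c_ j.
Proof.
have br s t : c_ s * c_ t * c_ i - c_ i * (c_ s * c_ t) =
    (2%:R * (i == dual_index t)%:R : E) *: c_ s - (2%:R * (i == dual_index s)%:R : E) *: c_ t.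
  transitivity (c_ s * (c_ t * c_ i + c_ i * c_ t) - (c_ s * c_ i + c_ i * c_ s) * c_ t).
    by rewrite mulrDr mulrDl !mulrA opprD addrA addrK.
  by rewrite !clifford_gen mulr_algr mulr_algl.
transitivity (\sum_j ((4%:R * (i == dual_index q)%:R) *: ((j == r)%:R *: c_ j)
                    - (4%:R * (i == dual_index r)%:R) *: ((j == q)%:R *: c_ j))); last first.
  by apply: eq_bigr => j _; rewrite mxE scalerBl !scalerA -!mulrA -!natrM !mulnb.
have pick s (z : E) : \sum_j z *: ((j == s)%:R *: c_ j) = z *: c_ s.
  rewrite (bigD1 s) //= eqxx scale1r big1 ?addr0 // => j /negPf ->.
  by rewrite scale0r scaler0.
rewrite big_split /= sumrN !pick /bivector mulrBl mulrBr.
rewrite opprD opprK addrACA [X in _ + X]addrC -[X in _ + X]opprB !br opprB addrACA.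
rewrite -!scalerDl -opprD -scalerDl.
by congr (_ *: _ - _ *: _); ring.
Qed.

Variables (r q : 'I_(n + n)) (u : E).
Let r' := dual_index r.
Let q' := dual_index q.
Let k : E0 := lam^-1 * a r * a q.
Let u' : E := conj u * k%:A.
(** A multiple of a bivector plus its image under J, which acts antilinearly on bivectors with
    coefficient lambda^-1 a_r a_q. The sum is fixed by J and so lies in the Lie algebra of G. *)
Definition skew_rotation : C := u *: bivector r q + u' *: bivector r' q'.
Definition skew_rotation_mx : 'M[E]_(n + n) :=
  u *: bivector_mx r q + u' *: bivector_mx r' q'.
Let y := skew_rotation.
Let N := skew_rotation_mx.

Let NE i j : N i j = u * bivector_mx r q i j + u' * bivector_mx r' q' i j.
Proof. by rewrite /N /skew_rotation_mx !mxE. Qed.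

Let y_bracket i : y * c_ i - c_ i * y = \sum_j N i j *: c_ j.
Proof.
rewrite /y /skew_rotation mulrDl mulrDr -!scalerAl -!scalerAr opprD addrACA -!scalerBr !bivector_bracket.
rewrite !scaler_sumr -big_split; apply: eq_bigr => j _.
by rewrite /= !scalerA -scalerDl -NE.
Qed.

Let bivector_mx_sym s t i j :
  bivector_mx s t i (dual_index j) + bivector_mx s t j (dual_index i) = 0.
Proof.
have dE (v w : 'I_(n + n)) : (dual_index v == w) = (v == dual_index w).
  by rewrite -{1}[w]dual_indexK (can_eq (@dual_indexK n)).
by rewrite !mxE !dE -!mulnb !natrM; ring.
Qed.

Let N_sym i j : N i (dual_index j) + N j (dual_index i) = 0.
Proof.
by rewrite !NE addrACA -!mulrDr !bivector_mx_sym !mulr0 addr0.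
Qed.

Let N_herm i j : N i j * (a j)%:A + (a i)%:A * conj (N j i) = 0.
Proof.
have l0 := good_basis_lambda_neq0 he n_gt0.
have hk1 : k%:A * (a q')%:A = (a r)%:A :> E.
  rewrite -algM; congr (_%:A); transitivity (lam^-1 * (a q * a q') * a r).
    by rewrite /k; ring.
  by rewrite (good_basis_dual he) mulVf // mul1r.
have hk2 : k%:A * (a r')%:A = (a q)%:A :> E.
  rewrite -algM; congr (_%:A); transitivity (lam^-1 * (a r * a r') * a q).
    by rewrite /k; ring.
  by rewrite (good_basis_dual he) mulVf // mul1r.
have dd s t : (s == t)%:R * (a s)%:A = (s == t)%:R * (a t)%:A :> E.
  by case: eqP => [->|]; rewrite ?mul0r.
have ck : conj k%:A = k%:A by rewrite linearZ /= rmorph1.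
rewrite !NE !mxE -!mulnb !natrM rmorphD !rmorphM !rmorphB !rmorphM /= !rmorph_nat (conjK hE hconj) ck.
rewrite /r' /q' !dual_indexK -/r' -/q'.
exact: herm_identity hk1 hk2 (dd _ _) (dd _ _) (dd _ _) (dd _ _) (dd _ _) (dd _ _) (dd _ _) (dd _ _).
Qed.

Section Point.
Variables (B : comAlgType E) (eta : B).
Hypothesis eta_sqr : eta * eta = 0.
Let x : tens C B := 1 + pure y eta.
Let g : 'M[B]_(n + n) := 1%:M + eta *: map_mx (in_alg B) N.

Lemma infinitesimal_covers : covers e iota x g.
Proof.
move=> i.
have -> : \sum_j pure (iota (tnth e j)) (g i j) = pure (c_ i) 1 + pure (y * c_ i - c_ i * y) eta.
  rewrite y_bracket pure_suml -[pure (c_ i) 1]addr0.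
  transitivity (\sum_j (pure (c_ j) ((i == j)%:R : B) + pure (N i j *: c_ j) eta)).
    apply: eq_bigr => j _; rewrite !mxE pureDr pureZ; congr (_ + pure _ _).
    by rewrite mulrC mulr_algl.
  rewrite big_split /= addr0; congr (_ + _).
  by rewrite (bigD1 i) //= eqxx big1 ?addr0 // => j /negPf ji; rewrite eq_sym ji pure0r.
exact: pure_bracket eta_sqr.
Qed.

(** Reversal negates bivectors, so it sends 1 + y eta to 1 - y eta, which is the inverse because
    eta^2 = 0. *)
Lemma infinitesimal_spin : Spin_points e iota x.
Proof.
pose word (i j : 'I_(n + n)) := [:: tnth e i; tnth e j].
pose s : seq (B * seq W) := [:: (1, [::]); (u *: eta, word r q); (- (u *: eta), word q r);
   (u' *: eta, word r' q'); (- (u' *: eta), word q' r')].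
have pw i j t : pure (\prod_(w <- word i j) iota w) t = pure (c_ i * c_ j) t.
  by rewrite !big_cons big_nil mulr1.
have ce (l : seq (B * seq W)) : clifford_expr iota l =
    foldr (fun t v => pure (\prod_(w <- t.2) iota w) t.1 + v) 0 l.
  by elim: l => [|t l IH]; rewrite /clifford_expr ?big_nil // big_cons /= -IH.
have hs : x = clifford_expr iota s.
  by rewrite ce /= -/(word _ _) !pw big_nil addr0 -pure_commutators.
have hr : clifford_expr iota (rev_expr s) = 1 - pure y eta.
  rewrite ce /= -/(word _ _) !pw big_nil addr0 -pureNl.
  have -> : - y = u *: (c_ q * c_ r - c_ r * c_ q) + u' *: (c_ q' * c_ r' - c_ r' * c_ q').
    by rewrite /y /skew_rotation /bivector opprD -!scalerN !opprB.
  by rewrite pure_commutators.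
split; last by exists g; exact: infinitesimal_covers.
exists s; split=> //; rewrite hr /x.
have pp : pure y eta * pure y eta = 0 by rewrite pureM eta_sqr pure0r.
split; [rewrite mulrBr | rewrite mulrBl];
  by rewrite ?mulr1 ?mul1r ?mulrDl ?mulrDr pp ?mulr1 ?mul1r addr0 addrK.
Qed.

End Point.

Variables (A : comAlgType E0) (eps : A).
Hypothesis eps_sqr : eps * eps = 0.
Let B := extend E A.
Let eta : B := inr_extend E eps.
Let eta_sqr : eta * eta = 0.
Proof. by rewrite -rmorphM eps_sqr rmorph0. Qed.

Let g : 'M[B]_(n + n) := 1%:M + eta *: map_mx (in_alg B) N.

Let map_algE (L : 'M[E]_(n + n)) i j : map_mx (in_alg B) L i j = (L i j)%:A.
Proof. by rewrite mxE. Qed.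

Lemma infinitesimal_SO : SO_points b e g.
Proof.
have hb : g *m gram e B b *m g^T = gram e B b.
  have -> : g^T = 1%:M + eta *: (map_mx (in_alg B) N)^T by rewrite linearD linearZ /= trmx1.
  apply: infinitesimal_form eta_sqr _; apply/matrixP => i j.
  rewrite mxE (mulmx_gram he) (gram_mulmx he) [X in _ + X]mxE !map_algE -scalerDl N_sym.
  by rewrite scale0r [RHS]mxE.
(* The determinant is 1 + t with t^2 = 0, and orthogonality makes its square 1; hence 2t = 0. *)
split=> //; have [d hd] := det_1addZ eta (map_mx (in_alg B) N).
have := congr1 determinant hb; rewrite !det_mulmx det_tr.
have /(congr1 determinant) := gram_sqr he A; rewrite det_mulmx det1.
rewrite /g hd; set t := eta * d => h1 h2.
have tt : t * t = 0 by rewrite /t mulrACA eta_sqr mul0r.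
suff t0 : t = 0 by rewrite t0 addr0.
have h3 : 2%:R * t = 0.
  transitivity ((1 + t) * \det (gram e B b) * (1 + t) * \det (gram e B b) - 1 - t * t
    - ((1 + t) * (1 + t)) * (\det (gram e B b) * \det (gram e B b) - 1)); first by ring.
  by rewrite h2 h1 tt subrr mulr0 !subr0.
have two0 := imaginary_quadratic_natrE hE 1.
rewrite -[t]mul1r -[1](rmorph1 (in_alg B)) -(mulVf two0) rmorphM rmorph_nat -mulrA h3.
by rewrite mulr0.
Qed.

Lemma infinitesimal_SU : SU_points conj psi e g.
Proof.
split; last by case: infinitesimal_SO.
have -> : (map_mx (@conj_extend E0 E conj A) g)^T =
    1%:M + eta *: (map_mx (in_alg B) (map_mx conj N))^T.
  apply/matrixP => i j; rewrite !mxE rmorphD rmorphM /= conj_extend_inr conj_extend_alg eq_sym.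
  by rewrite rmorph_nat.
apply: infinitesimal_form eta_sqr _; apply/matrixP => i j.
have h1 : (map_mx (in_alg B) N *m gram e B psi) i j = (N i j)%:A * ((a j)%:A : E)%:A.
  rewrite mxE (bigD1 j) //= big1 ?addr0; last by move=> l lj; rewrite (gram_herm he) (negPf lj) mulr0.
  by rewrite (gram_herm he) eqxx mulr1n map_algE.
have h2 : (gram e B psi *m (map_mx (in_alg B) (map_mx conj N))^T) i j =
    ((a i)%:A : E)%:A * (conj (N j i))%:A.
  rewrite mxE (bigD1 i) //= big1 ?addr0; last first.
    by move=> l lj; rewrite (gram_herm he) eq_sym (negPf lj) mul0r.
  by rewrite (gram_herm he) eqxx mulr1n mxE map_algE mxE.
rewrite mxE h1 h2 [RHS]mxE.
by have := congr1 (in_alg B) (N_herm i j); rewrite rmorphD !rmorphM rmorph0.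
Qed.

Lemma infinitesimal_preimage : G_preimage conj b psi e iota (1 + pure y eta : point C A).
Proof.
split; first exact: infinitesimal_spin.
exists g; first exact: infinitesimal_covers.
by split; [exact: infinitesimal_SO | exact: infinitesimal_SU].
Qed.

End Infinitesimal.

Section InfinitesimalG1.
Variables (E0 : fieldType) (E : fieldExtType E0) (conj : {lrmorphism E -> E}).
Variables (W : vectType E) (n : nat) (b psi : W -> W -> E) (e : (n + n).-tuple W).
Variables (a : 'I_(n + n) -> E0) (lam : E0).
Variables (C : falgType E) (iota : {linear W -> C}).
Variable act : C -> {linear exterior E n -> exterior E n}.
Hypotheses (hE : imaginary_quadratic E) (hconj : is_conjugation conj).
Hypotheses (he : good_basis conj b psi e a lam) (hact : is_spin_module iota e act).
Hypotheses (hC : clifford_map b iota).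
Hypotheses (n_even : ~~ odd n) (n_gt0 : (0 < n)%N).
Variable p : bool.

Let d := #|half_index n p|.
Let dual : comAlgType E0 := dual_number E0.
Let eta : extend E dual := inr_extend E (dual_eps E0).

(* An idempotent regular function equal to 1 at the identity is 1 modulo eps, *)
(* hence 1, at every point that reduces to the identity modulo eps.           *)
Lemma infinitesimal_G1 r q u :
  G1 conj b psi e iota (1 + pure (skew_rotation conj e a lam iota r q u) eta : point C dual).
Proof.
set y := skew_rotation _ _ _ _ _ _ _ _.
have hx : G_preimage conj b psi e iota (1 + pure y eta : point C dual).
  by apply: (infinitesimal_preimage hE hconj he hC n_gt0); exact: dual_eps_sqr.
split=> // f freg fidem f1; apply: dual_idempotent.
- exact: imaginary_quadratic_natr hE 1.
- exact: fidem.
rewrite -(freg dual dual (dual_augmentation E0) _ hx) -[RHS](f1 dual); congr (f dual _).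
rewrite /point_map (tens_mapD (extend_map (dual_augmentation E0))).
rewrite (tens_map1 _ (extend_map (dual_augmentation E0))) -[RHS]addr0; congr (_ + _).
rewrite (tens_map_pure (extend_map (dual_augmentation E0))) /= extend_map_inr dual_aug_eps.
by rewrite rmorph0 pure0r.
Qed.

Lemma eta_scale_inj (z z' : E) :
  eta * z%:A = eta * z'%:A :> extend E dual -> z = z'.
Proof.
rewrite ![eta * _]mulrC -!extend_pureE => h; apply: v2r_inj; apply/rowP => i.
have := congr1 (fun t => tcoef t i) h; rewrite !tcoef_pure !mulr_algr => -[_].
by rewrite !regular_scaleE !mulr1.
Qed.

Let toB : 'M[E]_d -> 'M[extend E dual]_d := map_mx (in_alg (extend E dual)).

(** A descent makes the matrix of 1 + y eta, conjugated by P, rational over the dual numbers of E_0;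
    its eps-coefficient is therefore fixed by conjugation. *)
Lemma skew_rotation_conj (P : 'M[E]_d) (S : 'M[dual]_d) r q u :
  let y := skew_rotation conj e a lam iota r q u in
  P \in unitmx ->
  toB P *m half_spin act p (1 + pure y eta : point C dual) =
    map_mx (inr_extend E) S *m toB P ->
  map_mx conj (P *m rho act p y *m invmx P) = P *m rho act p y *m invmx P.
Proof.
move=> y uP h; set V := P *m _ *m _.
have : map_mx (inr_extend E) S = 1%:M + eta *: toB V.
  apply: (conjugate_infinitesimal uP); rewrite -h; congr (_ *m _).
  by rewrite (half_spinD act) (half_spin1 hact) (half_spin_pure hact).
move=> hS; have : map_mx (@conj_extend E0 E conj dual) (map_mx (inr_extend E) S) =
    map_mx (inr_extend E) S.
  by apply/matrixP => i j; rewrite !mxE conj_extend_inr.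
rewrite hS => hV; apply/matrixP => i j; apply: eta_scale_inj.
move/matrixP/(_ i j): hV; rewrite ![_ i j]mxE /= rmorphD rmorph_nat => /addrI.
rewrite ![(_ *: toB V) i j]mxE /= ![toB _ i j]mxE rmorphM /= conj_extend_inr conj_extend_alg.
by move=> <-; congr (_ * _%:A); rewrite mxE.
Qed.

End InfinitesimalG1.

(** * Norms from a descended module *)

(** J^2 = lambda on vectors, so its action on bivectors, normalised by lambda^-1, is an
    involution. *)
Lemma bivector_weight (E0 : fieldType) (E : fieldExtType E0) (conj : {lrmorphism E -> E})
    (W : vectType E) n (b psi : W -> W -> E) (e : (n + n).-tuple W) a lam :
  good_basis conj b psi e a lam -> (0 < n)%N -> forall r q,
  lam^-1 * a r * a q * (lam^-1 * a (dual_index r) * a (dual_index q)) = 1.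
Proof.
move=> he n0 r q.
transitivity (lam^-1 * (a r * a (dual_index r)) * (lam^-1 * (a q * a (dual_index q)))).
  by ring.
by rewrite !(good_basis_dual he) mulVf ?mulr1 // (good_basis_lambda_neq0 he n0).
Qed.

Section DefinedNorm.
Variables (E0 : fieldType) (E : fieldExtType E0) (conj : {lrmorphism E -> E}).
Variables (W : vectType E) (n : nat) (b psi : W -> W -> E) (e : (n + n).-tuple W).
Variables (a : 'I_(n + n) -> E0) (lam : E0).
Variables (C : falgType E) (iota : {linear W -> C}).
Variable act : C -> {linear exterior E n -> exterior E n}.
Hypotheses (hE : imaginary_quadratic E) (hconj : is_conjugation conj).
Hypotheses (he : good_basis conj b psi e a lam) (hact : is_spin_module iota e act).
Hypotheses (hC : clifford_map b iota).
Hypotheses (n_even : ~~ odd n) (n_gt0 : (0 < n)%N).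
Variable p : bool.

Let M : 'M[E]_#|half_index n p| := star_mx E lam a p.
Let w (r q : 'I_(n + n)) := gen2_mx E p r q - gen2_mx E p q r.

Let rho_bivector r q : rho act p (bivector e iota r q) = w r q.
Proof. by rewrite /bivector (rhoB hact) !(rho_gen2 hact). Qed.

Let Mw r q : M *m w r q =
  (lam^-1 * a r * a q)%:A *: (w (dual_index r) (dual_index q) *m M).
Proof.
have l0 := good_basis_lambda_neq0 he n_gt0.
rewrite mulmxBr !(star_mx_gen2 E n_even p _ _ (gb_lambda he) l0) mulmxBl scalerBr.
by congr (_ - _ *: _); rewrite -!mulrA (mulrC (a q)).
Qed.

Let w_conj r q : map_mx conj (w r q) = w r q.
Proof. by rewrite map_mxB !gen2_mx_conj. Qed.

Lemma defined_star_sqr_norm : defined_over_E0 conj b psi e iota act p ->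
  is_norm conj (star_sqr lam a p).
Proof.
case=> S [P [_ uP hP]].
pose Q := invmx (map_mx conj P) *m P.
have ucP : map_mx conj P \in unitmx by rewrite map_unitmx.
have uQ : Q \in unitmx by rewrite unitmx_mul unitmx_inv ucP uP.
(* The descent gives S^p the antilinear involution s |-> P^-1 conj(P s). Following it by conjugation
   and then M is the linear map T. *)
pose T := M *m Q.
pose V r q u := rho act p (skew_rotation conj e a lam iota r q u).
have VE r q u : V r q u = u *: w r q +
    (conj u * (lam^-1 * a r * a q)%:A) *: w (dual_index r) (dual_index q).
  by rewrite /V /skew_rotation (rhoD hact) !(rhoZ hact) !rho_bivector.
have VQ r q u : map_mx conj (V r q u) *m Q = Q *m V r q u.
  have := skew_rotation_conj hact uP (hP _ _ (infinitesimal_G1 hE hconj he hC n_gt0 r q u)).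
  rewrite -/(V r q u) !map_mxM map_invmx /Q => h.
  rewrite -[LHS]mul1mx -(mulVmx ucP) -!mulmxA.
  rewrite (mulmxA (map_mx conj (V r q u))) (mulmxA (map_mx conj P)) (mulmxA (map_mx conj P)) h.
  by rewrite -!mulmxA mulVmx // mulmx1.
have MV r q u : M *m map_mx conj (V r q u) = V r q u *m M.
  rewrite VE map_mxD !map_mxZ !w_conj mulmxDr mulmxDl -!scalemxAr -!scalemxAl !Mw !dual_indexK.
  rewrite !scalerA rmorphM /= (conjK hE hconj) linearZ /= rmorph1 addrC.
  congr (_ *: _ + _); rewrite -(mulrA u) -algM.
  rewrite (_ : lam^-1 * a r * a q * _ = 1) ?scale1r ?mulr1 //.
  exact: bivector_weight he n_gt0 r q.
have TV r q u : T *m V r q u = V r q u *m T.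
  by rewrite /T -mulmxA -VQ !mulmxA MV.
have Tw r q : T *m w r q = w r q *m T.
  have [theta th0 cth] := imaginary_element hE hconj.
  have two0 := imaginary_quadratic_natrE hE 1.
  (* The parameters 1 and theta isolate one bivector: as conj theta = -theta, the J-image terms
     cancel. *)
  have hw : w r q = (2%:R * theta)^-1 *: (theta *: V r q 1 + V r q theta).
    rewrite !VE rmorph1 mul1r scale1r cth (scalerDr theta) !scalerA addrACA mulNr scaleNr subrr addr0.
    by rewrite -scalerDl scalerA -mulr2n -(mulr_natl theta) mulVf ?mulf_neq0 // scale1r.
  by rewrite hw -scalemxAr -scalemxAl mulmxDr mulmxDl -scalemxAr -scalemxAl !TV.
have [mu hmu] : exists mu, T = mu%:M.
  apply: (@commutant_scalar _ _ n p (imaginary_quadratic_natrE hE 1) E idfun) => // r q.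
  have -> : spin_mx p (gen_comm r q) = w r q.
    by apply/matrixP => i j; rewrite !mxE ffunE [in X in _ + X]ffunE.
  by rewrite map_mx_id.
have hM : M = mu *: (invmx P *m map_mx conj P).
  rewrite -[LHS]mulmx1 -(mulmxV uQ) mulmxA -/T hmu mul_scalar_mx; congr (_ *: _).
  have hQ : Q *m (invmx P *m map_mx conj P) = 1%:M.
    by rewrite /Q mulmxA -(mulmxA _ P) mulmxV // mulmx1 mulVmx.
  by rewrite -[LHS]mulmx1 -hQ mulmxA mulVmx // mul1mx.
(* M is fixed by conjugation, so M^2 = M conj(M), where P^-1 conj(P) meets its own conjugate and
   cancels. *)
have MM : M *m M = (mu * conj mu)%:M.
  have ccP : map_mx conj (map_mx conj P) = P.
    by apply/matrixP => i j; rewrite !mxE conjK.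
  rewrite -[X in _ *m X](star_mx_conj conj lam a p) -/M hM map_mxZ map_mxM ccP map_invmx.
  rewrite -scalemxAl -scalemxAr scalerA -mulmxA (mulmxA (map_mx conj P)) mulmxV // mul1mx.
  by rewrite mulVmx // scalemx1.
have hmm : (star_sqr lam a p)%:A = mu * conj mu.
  by apply: (scalar_mx_inj (half_index_gt0 n_gt0 p)); rewrite -MM star_mx_sqr.
exists mu => //; apply: contraNneq (star_sqr_neq0 hE he n_gt0 p) => mu0.
by rewrite -(fmorph_eq0 (in_alg E)) /= hmm mu0 mul0r.
Qed.

End DefinedNorm.

(** * The constant c_p modulo norms *)

Section Norms.
Variables (E0 : fieldType) (E : fieldExtType E0) (conj : {lrmorphism E -> E}).

(** The square of k in E_0^* is the norm of k. *)
Lemma is_norm_mul_sqr (x k : E0) : k != 0 -> is_norm conj (x * k ^+ 2) <-> is_norm conj x.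
Proof.
have mul_sqr y l : l != 0 -> is_norm conj y -> is_norm conj (y * l ^+ 2).
  move=> l0 [z z0 hz]; exists (z * l%:A).
    by rewrite mulf_neq0 // -in_algE fmorph_eq0.
  rewrite rmorphM /= linearZ /= rmorph1 expr2 !algM hz; exact: mulrACA.
move=> k0; split; last exact: mul_sqr.
move=> /(mul_sqr _ k^-1); rewrite invr_eq0 => /(_ k0).
by rewrite -mulrA -exprMn mulfV // expr1n mulr1.
Qed.

(** Two consecutive indices contribute -1; this is the origin of the sign (-1)^m in front of D. *)
Lemma prod_sign_double m n : n = (2 * m)%N -> \prod_(i < n) (-1) ^+ i = (-1) ^+ m :> E0.
Proof.
move=> ->; elim: m => [|m IH]; first by rewrite big_ord0.
rewrite mulnS !big_ord_recr /= IH !exprS exprM sqrrN !expr1n.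
by ring.
Qed.

Lemma star_sqr_is_norm m n (p : bool) (lam : E0) (a : 'I_(n + n) -> E0) :
  (0 < m)%N -> n = (2 * m)%N -> (2%:R : E0) != 0 -> lam != 0 ->
  is_norm conj (star_sqr lam a p) <->
  is_norm conj ((-1) ^+ m * \prod_(i < n) a (lshift n i) * lam ^+ (odd m (+) p)).
Proof.
move=> m0 hn two0 lam0.
set D := \prod_(i < n) _.
(* The negative exponent is rounded with [uphalf], so that the leftover power of lambda is 0 or 1; m
   > 0 keeps the natural subtraction exact. *)
have half : lam ^- (m - p) = lam ^+ (odd m (+) p) * (lam ^- uphalf (m - p)) ^+ 2.
  have -> : odd m (+) p = odd (m - p) by rewrite oddB ?oddb //; case: p.
  set r := (m - p)%N; rewrite -exprVn -exprVn -exprM muln2.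
  rewrite -[X in lam^-1 ^+ X = _]odd_double_half uphalf_half doubleD !exprD.
  rewrite [_ ^+ (odd r).*2](_ : _ = lam^-1 ^+ odd r * lam^-1 ^+ odd r).
    by rewrite !mulrA -exprMn mulfV // expr1n mul1r.
  by rewrite -addnn exprD.
have -> : star_sqr lam a p =
    ((-1) ^+ m * D * lam ^+ (odd m (+) p)) * (2%:R ^+ m * lam ^- uphalf (m - p)) ^+ 2.
  rewrite /star_sqr !big_split /= -/D prodr_const card_ord (prod_sign_double hn).
  have -> : (n./2 = m)%N by rewrite hn mul2n doubleK.
  rewrite half hn exprM; set z := lam ^- _; set l := lam ^+ _.
  by rewrite [in LHS]exprAC; ring.
apply: is_norm_mul_sqr.
by rewrite mulf_neq0 ?invr_eq0 ?expf_neq0.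
Qed.

End Norms.

Theorem corollary3p4
    (E0 : fieldType) (E : fieldExtType E0) (conj : {lrmorphism E -> E})
    (hE : imaginary_quadratic E) (hconj : is_conjugation conj)
    (m n : nat) (hm : (0 < m)%N) (hn : n = (2 * m)%N)
    (W : vectType E) (b psi : W -> W -> E) (e : (n + n).-tuple W)
    (a : 'I_(n + n) -> E0) (lambda : E0)
    (he : good_basis conj b psi e a lambda)
    (C : falgType E) (iota : {linear W -> C})
    (hC : is_clifford_algebra b iota)
    (act : C -> {linear exterior E n -> exterior E n})
    (hact : is_spin_module iota e act)
    (D : E0) (hD : D = \prod_(i < n) a (lshift n i)) :
  let Splus_defined := defined_over_E0 conj b psi e iota act false in
  let Sminus_defined := defined_over_E0 conj b psi e iota act true in
  let D_norm := is_norm conj ((-1) ^+ m * D) in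
  let Dlambda_norm := is_norm conj ((-1) ^+ m * D * lambda) in
  [/\ Splus_defined /\ Sminus_defined <-> D_norm /\ Dlambda_norm,
      Splus_defined /\ ~ Sminus_defined <->
        (~~ odd m /\ D_norm /\ ~ Dlambda_norm)
        \/ (odd m /\ ~ D_norm /\ Dlambda_norm),
      Sminus_defined /\ ~ Splus_defined <->
        (odd m /\ D_norm /\ ~ Dlambda_norm)
        \/ (~~ odd m /\ ~ D_norm /\ Dlambda_norm)
    & ~ Splus_defined /\ ~ Sminus_defined <-> ~ D_norm /\ ~ Dlambda_norm].
Proof.
move=> Splus Sminus Dn Dln.
have n_even : ~~ odd n by rewrite hn oddM.
have n_gt0 : (0 < n)%N by rewrite hn muln_gt0.
(* The exponent of lambda vanishes exactly when p has the parity of m, so the parity of m only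
   decides which of S^+ and S^- goes with which norm condition. *)
have defined p : defined_over_E0 conj b psi e iota act p <->
    is_norm conj ((-1) ^+ m * D * lambda ^+ (odd m (+) p)).
  rewrite hD; apply: (iff_trans _ (@star_sqr_is_norm _ _ conj m n p lambda a hm hn _ _)).
  - split; first exact: defined_star_sqr_norm hE hconj he hact (proj1 hC) n_even n_gt0 p.
    exact: star_sqr_norm_defined hE hconj he hact n_even n_gt0 p.
  - exact: imaginary_quadratic_natr hE 1.
  - exact: good_basis_lambda_neq0 he n_gt0.
have dp := defined false; have dm := defined true; rewrite addbF in dp; rewrite addbT in dm.
have [o|o] := boolP (odd m); move: dp dm; rewrite ?o ?(negPf o) /= ?expr1 ?expr0 ?mulr1;
  rewrite -/Splus -/Sminus -/Dn -/Dln => dp dm.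
  by split; intuition.
by split; intuition.
Qed.
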